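(* Let $\mu\in\mathcal P$ and let $f$ be as in the context, with $\alpha:=f'(\infty)<\infty$. (i) Suppose that $m^\mu>0$ and $\mu(\{0\})=0$. Assume that $\theta\in L^1_+$ with $S\theta\in L^1$, $\lambda\ge0$ and $\eta\in\mathbb R$ satisfy, for $\mu$-almost every $u$, \[ \alpha-\lambda-\eta\bigl(S(u)-S(0)\bigr)\in\partial f\bigl(\theta(u)\bigr), \] together with \[ \int_{[0,\rho)}\theta(u)\,\mu(\mathrm{d}u)\le1,\qquad \int_{[0,\rho)}\theta(u)\bigl(S(u)-S(0)\bigr)\,\mu(\mathrm{d}u)=-S(0), \] and $\lambda\left(\int_{[0,\rho)}\theta(u)\,\mu(\mathrm{d}u)-1\right)=0$. Define $\nu_0:=1-\int_{[0,\rho)}\theta(u)\,\mu(\mathrm{d}u)$ and $\mathrm{d}\nu:=\nu_0\,\mathrm{d}\delta_0+\theta\,\mathrm{d}\mu$. Then Problem (B') has at least one solution $\widehat\nu$ such that $\mu\succeq\widehat\nu$. (ii) Suppose that $m^\mu<0$. Fix $M\in[r_0,\rho)$ such that $\operatorname{supp}\mu\subseteq[0,M]$ and $\mu(\{M\})=0$. Assume that $\theta\in L^1_+$ with $S\theta\in L^1$, $\lambda\ge0$ and $\eta\in\mathbb R$ satisfy, for $\mu$-almost every $u$, \[ \alpha-\lambda-\eta\bigl(S(u)-S(M)\bigr)\in\partial f\bigl(\theta(u)\bigr), \] together with \[ \int_{[0,M]}\theta(u)\,\mu(\mathrm{d}u)\le1,\qquad \int_{[0,M]}\theta(u)\bigl(S(u)-S(M)\bigr)\,\mu(\mathrm{d}u)=-S(M),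 \] and $\lambda\left(\int_{[0,M]}\theta(u)\,\mu(\mathrm{d}u)-1\right)=0$. Define $\nu_M:=1-\int_{[0,M]}\theta(u)\,\mu(\mathrm{d}u)$ and $\mathrm{d}\nu:=\nu_M\,\mathrm{d}\delta_M+\theta\,\mathrm{d}\mu$. Then Problem (CM') has at least one solution $\widehat\nu$ such that $\widehat\nu\succeq\mu$.
   Context: Scale function: $I=(\ell,\rho)$ with $-\infty\le\ell<0<r_0<\rho\le\infty$; $a,\sigma:I\to\mathbb R$ are Borel, $\sigma^2>0$ on $I$, and $1/\sigma^2$, $|a|/\sigma^2$ are locally integrable on $I$; $S(x):=\int_{r_0}^x\exp\{-2\int_{r_0}^u\frac{a(r)}{\sigma^2(r)}\mathrm{d}r\}\mathrm{d}u$ for $x\in I$. Thus $S$ is continuous and strictly increasing with $S(r_0)=0$. $\mathcal P$ is the set of probability measures $\nu$ on $[0,\rho)$ with $\int_{[0,\rho)}|S|\,\mathrm{d}\nu<\infty$; for $\nu\in\mathcal P$, $m^\nu:=\int_{[0,\rho)}S(u)\,\nu(\mathrm{d}u)$. $\mathcal P^M:=\{\nu\in\mathcal P:\operatorname{supp}\nu\subseteq[0,M]\}$. $L^1:=L^1([0,\rho),\mathcal B([0,\rho)),\mu)$, and $L^1_+$ is its cone of nonnegative functions. $\delta_x$ is the Dirac measure at $x$. Stochastic dominance: $\nu\succeq\mu$ means $\nu((-\infty,x])\le\mu((-\infty,x])$ for all $x\in\mathbb R$. Divergence: $f:(0,\infty)\to\mathbb R$ is convex, extended by $f(0):=\lim_{x\downarrow0}f(x)\in(-\infty,\infty]$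 and $f(x)=\infty$ for $x<0$; $f'(\infty):=\lim_{x\to\infty}f(x)/x$. Standing assumption: $f\ge0$, $f(1)=0$, $f'(\infty)\ge0$. For $\nu\in\mathcal P$ with Lebesgue decomposition $\nu=\theta\mu+\nu^\perp$ with respect to $\mu$, $D_f(\nu\,\Vert\,\mu):=\int_{[0,\rho)}f(\theta)\,\mathrm{d}\mu+f'(\infty)\,\nu^\perp([0,\rho))$. Subdifferential: for $x\ge0$ with $f(x)<\infty$, $\partial f(x):=\{z\in\mathbb R: f(y)\ge f(x)+z(y-x)\ \text{for all }y\in\mathbb R\}$; $\partial f(x):=\emptyset$ if $f(x)=\infty$. Problem (B') (for $m^\mu>0$): minimize $D_f(\nu\,\Vert\,\mu)$ over $\nu\in\mathcal P$ subject to $m^\nu=0$. Problem (CM') (for $m^\mu<0$, $\operatorname{supp}\mu\subseteq[0,M]$): minimize $D_f(\nu\,\Vert\,\mu)$ over $\nu\in\mathcal P^M$ subject to $m^\nu=0$ and $\nu\succeq\mu$. *)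

(* Defs.v *)
From HB Require Import structures.
From mathcomp Require Import all_boot all_order all_algebra.
From mathcomp Require Import all_classical all_reals all_analysis.
From mathcomp Require Import measurable_realfun.
Import Order.TTheory GRing.Theory Num.Theory.
Import numFieldNormedType.Exports.

Set Implicit Arguments.
Unset Strict Implicit.
Unset Printing Implicit Defensive.

Local Open Scope classical_set_scope.
Local Open Scope ring_scope.
Local Open Scope ereal_scope.

Definition eitv_oo {R : realType} (ell rho : \bar R) : set R :=
  [set x | ell < x%:E /\ x%:E < rho].

Definition eitv0 {R : realType} (rho : \bar R) : set R :=
  [set x | (0 <= x)%R /\ x%:E < rho].

(* Integral from c to x, negated when x < c. *)
Definition oriented_integral {R : realType} (c x : R) (g : R -> R) : R :=
  if (c <= x)%R then (\int[lebesgue_measure]_(t in `[c, x]) g t)%R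
  else (- \int[lebesgue_measure]_(t in `[x, c]) g t)%R.

Definition scale_function {R : realType} (r0 : R) (a sigma : R -> R) (x : R) : R :=
  oriented_integral r0 x (fun u =>
    expR (- 2 * oriented_integral r0 u (fun r => a r / sigma r ^+ 2))%R).

(* Measures on [0, rho) are measures on the real line that give no mass to the
   complement, so that supports and distribution functions are those of R. *)
Definition calP {R : realType} (rho : \bar R) (S : R -> R) :
    set (probability (measurableTypeR R) R) :=
  [set nu | nu (eitv0 rho) = 1 /\ \int[nu]_(x in eitv0 rho) `|S x|%:E < +oo].

Definition mean {R : realType} (rho : \bar R) (S : R -> R)
    (nu : probability (measurableTypeR R) R) : R :=
  (\int[nu]_(u in eitv0 rho) S u)%R.

Definition msupport {R : realType} (nu : set R -> \bar R) : set R :=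
  [set x | forall U : set R, open U -> U x -> 0 < nu U].

Definition calPM {R : realType} (rho : \bar R) (S : R -> R) (M : R) :
    set (probability (measurableTypeR R) R) :=
  calP rho S `&` [set nu | msupport nu `<=` `[0%R, M]].

(* nu dominates mu. *)
Definition stoch_dominates {R : realType} (nu mu : set R -> \bar R) : Prop :=
  forall x : R, nu `]-oo, x]%classic <= mu `]-oo, x]%classic.

(* Only the values of f on (0, +oo) matter. *)
Definition extend {R : realType} (f : R -> R) (x : R) : \bar R :=
  if (0 < x)%R then (f x)%:E
  else if x == 0%R then lim ((f y)%:E @[y --> 0^'+])
  else +oo.

(* f'(oo) *)
Definition slope_infty {R : realType} (f : R -> R) : \bar R :=
  lim ((f x / x)%:E @[x --> +oo%R]).

Definition subdifferential {R : realType} (f : R -> R) (x : R) : set R :=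
  [set z | extend f x < +oo /\
           forall y : R, extend f x + (z * (y - x))%:E <= extend f y].

Definition lebesgue_decomposition {R : realType}
    (mu nu : probability (measurableTypeR R) R) (theta : R -> R)
    (nuperp : {finite_measure set (measurableTypeR R) -> \bar R}) : Prop :=
  [/\ measurable_fun setT theta,
      forall x, (0 <= theta x)%R,
      (exists N : set R, [/\ measurable N, mu N = 0 & nuperp (~` N) = 0]) &
      forall A : set R, measurable A ->
        nu A = \int[mu]_(x in A) (theta x)%:E + nuperp A].

Lemma lebesgue_decomposition_exists {R : realType}
    (mu nu : probability (measurableTypeR R) R) :
  exists theta nuperp, lebesgue_decomposition mu nu theta nuperp.
Proof.
pose E := [set e | exists A : set (measurableTypeR R),
  [/\ measurable A, mu A = 0 & nu A = e]].
have E1 : ereal_sup E <= 1.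
  by apply: ge_ereal_sup => _ [A [mA _ <-]]; exact: probability_le1.
have E0 : 0 <= ereal_sup E.
  apply: ereal_sup_ubound; exists set0; split; rewrite ?measure0//.
have Efin : ereal_sup E \is a fin_num.
  by rewrite ge0_fin_numE// (le_lt_trans E1)// ltry.
have /choice[A AP] n : exists A : set (measurableTypeR R),
    [/\ measurable A, mu A = 0 & ereal_sup E - n.+1%:R^-1%:E < nu A].
  have n0 : (0 < n.+1%:R^-1 :> R)%R by rewrite invr_gt0.
  by have [_ [A [mA A0 <-]] ?] := ub_ereal_sup_adherent n0 Efin; exists A.
pose N := \bigcup_n A n.
have mN : measurable N by apply: bigcupT_measurable => n; have [] := AP n.
have N0 : mu N = 0.
  apply/measure_negligible => //; apply: negligible_bigcup => n.
  by have [mA A0 _] := AP n; exact/negligibleP.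
have supN B : measurable B -> mu B = 0 -> nu B <= ereal_sup E.
  by move=> mB B0; apply: ereal_sup_ubound; exists B.
have nuN : nu N = ereal_sup E.
  apply/eqP; rewrite eq_le supN//=; apply/lee_addgt0Pr => e e0.
  near \oo => n; have [mA _ /ltW An] := AP n.
  rewrite -leeBlDr//; apply: le_trans (le_trans An _).
    rewrite leeB// lee_fin ltW//; near: n.
    exact: near_infty_natSinv_lt (PosNum e0).
  by rewrite le_measure ?inE//; exact: bigcup_sup.
have mCN : measurable (~` N) by exact: measurableC.
have fN (B : set (measurableTypeR R)) : measurable B -> nu B < +oo.
  by move=> mB; rewrite (le_lt_trans (probability_le1 _ mB))// ltry.
pose nua : {finite_measure set (measurableTypeR R) -> \bar R} :=
  mfrestr mCN (fN _ mCN).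
pose nus : {finite_measure set (measurableTypeR R) -> \bar R} :=
  mfrestr mN (fN _ mN).
have ac : nua `<< mu.
  apply/null_content_dominatesP => B mB B0.
  have mBN : measurable (B `&` ~` N) by exact: measurableI.
  have mu0 : mu (N `|` (B `&` ~` N)) = 0.
    rewrite measureU//; last by rewrite setICA setICr setI0.
    rewrite [X in X + _]N0 add0e; apply/eqP; rewrite eq_le measure_ge0 andbT.
    by rewrite -B0 le_measure ?inE//; exact: subIsetl.
  have := supN _ (measurableU _ _ mN mBN) mu0.
  rewrite measureU//; last by rewrite setICA setICr setI0.
  rewrite [X in X + _]nuN -[leRHS]adde0 leeD2lE// => le0.
  by apply/eqP; rewrite eq_le measure_ge0 andbT.
exists (fine \o Radon_Nikodym_SigmaFinite.f nua mu), nus.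
have fin := Radon_Nikodym_SigmaFinite.f_fin_num ac.
have mth : measurable_fun (setT : set (measurableTypeR R))
    (fine \o Radon_Nikodym_SigmaFinite.f nua mu).
  have mf := measurable_int _ (Radon_Nikodym_SigmaFinite.f_integrable ac).
  have m1 : measurable_fun [set: \bar R] (@fine R).
    exact: measurable_realfun.fine_measurable.
  exact: (measurableT_comp m1 mf).
split.
- exact: mth.
- by move=> x; rewrite fine_ge0// Radon_Nikodym_SigmaFinite.f_ge0.
- exists N; split => //.
  by rewrite /nus/= /mfrestr /mrestr setICl measure0.
- move=> B mB; under eq_integral do rewrite /= fineK//.
  rewrite -Radon_Nikodym_SigmaFinite.f_integral//.
  rewrite /nua/nus/= /mfrestr /mrestr.
  rewrite -measureU//.
  + by rewrite -setIUr setUCl setIT.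
  + exact: measurableI.
  + exact: measurableI.
  + by rewrite setIACA setICl setI0.
Unshelve. all: by end_near. Qed.

(* The decomposition is unique up to mu-null sets, so that for convex f exactly
   one value is eligible. *)
Definition divergence {R : realType} (rho : \bar R) (f : R -> R)
    (mu nu : probability (measurableTypeR R) R) : \bar R :=
  [get d : \bar R | exists theta nuperp,
    lebesgue_decomposition mu nu theta nuperp /\
    d = \int[mu]_(x in eitv0 rho) extend f (theta x)
        + slope_infty f * nuperp (eitv0 rho)].

Definition minimizer {T : Type} {R : realType} (A : set T) (F : T -> \bar R)
    (x : T) : Prop :=
  A x /\ forall y, A y -> F x <= F y.

Definition feasibleB {R : realType} (rho : \bar R) (S : R -> R) :
    set (probability (measurableTypeR R) R) :=
  [set nu | calP rho S nu /\ mean rho S nu = 0%R].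

Definition feasibleCM {R : realType} (rho : \bar R) (S : R -> R) (M : R)
    (mu : probability (measurableTypeR R) R) :
    set (probability (measurableTypeR R) R) :=
  [set nu | [/\ calPM rho S M nu, mean rho S nu = 0%R & stoch_dominates nu mu]].

(* Main.v *)
Require Import Defs.
From HB Require Import structures.
From mathcomp Require Import all_boot all_order all_algebra.
From mathcomp Require Import all_classical all_reals all_analysis.
From mathcomp Require Import measurable_realfun ring lra.
Import Order.TTheory GRing.Theory Num.Theory.
Import numFieldNormedType.Exports.

(** Both parts are instances of one problem. Put h = S - S 0 and c = 0 in the
    first, h = S M - S and c = M in the second: h is nonnegative on the set E
    that carries all the measures (the whole state space, resp. [0, M]), it
    vanishes at c, and a mean zero for S says that the moment of h is kappa, where
    kappa = - S 0, resp. S M. Monotonicity of S and the sign of the mean of mu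
    give 0 <= kappa < int h dmu. Changing the sign of eta in the second part, the
    prescribed subgradient is z = alpha - lambda - eta * h in both.

    Optimality is convex duality. The inequality f (theta) + z * (1 - theta) <= 0,
    which is the subgradient inequality at the zero 1 of f, integrates to
      int f (theta) dmu + alpha * (1 - int theta dmu)
        <= eta * (int h dmu - kappa)
    (optimal_density_cost), so eta >= 0. For a competitor with density theta' and
    singular part, integrating f (theta') >= f (theta) + z * (theta' - theta)
    gives that its divergence is at least that of nu, because lambda + eta * h is
    nonnegative wherever the singular part may sit (optimal_density_lower_bound).
    The divergence of nu itself is read off from its Lebesgue decomposition,
    theta being its density and the atom at c its singular part; this uses that c
    is not charged by mu, and that decompositions are unique
    (decomposition_uniq, divergenceE).

    Stochastic dominance needs a density that is nonincreasing in h: it then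
    crosses the level 1 once and loads the sets close to c more than mu does
    (lower_set_dominance). If eta > 0, z is strictly decreasing in h and theta is
    monotone by monotonicity of the subdifferential. If eta = 0, theta need not be
    monotone, and this is why the solution is not always nu; but then the cost
    inequality shows that nu has divergence zero, so that it suffices to find any
    monotone competitor of divergence zero. If alpha = 0, singular mass is free:
    take the constant density k = kappa / int h dmu and the mass 1 - k at c; k is
    a weighted average of theta, hence a zero of f. If alpha > 0, the zero set of
    f is a compact interval [p, q] and theta is a probability density with values
    in it; the Neyman-Pearson density with values p and q is monotone and has a
    moment at most kappa, and its mixture with the constant 1 has moment kappa
    (zero_density_rearrangement).

    The remaining facts are that S is strictly increasing
    (scale_function_lt), and that a probability supported in [0, M] gives full
    mass to that interval (msupport_full). *)

Set Implicit Arguments.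
Unset Strict Implicit.
Unset Printing Implicit Defensive.

Local Open Scope classical_set_scope.
Local Open Scope ring_scope.

(** * Convex functions extended to zero *)

Section convex_facts.
Context {R : realType} (f : R -> R).
Hypothesis f_convex : @convex_function R R^o `]0, +oo[%classic f.

Lemma convex_function_ineq (x y t : R) : 0 < x -> 0 < y -> 0 <= t <= 1 ->
  f (t * x + (1 - t) * y) <= t * f x + (1 - t) * f y.
Proof.
move=> x0 y0 t01.
have := @f_convex (Itv01 (andP t01).1 (andP t01).2) x y.
by rewrite !inE/= !in_itv/= x0 y0 => /(_ isT isT); rewrite !convRE.
Qed.

Lemma convex_function_quasi (x w y : R) : 0 < x -> x <= w -> w <= y ->
  f w <= Num.max (f x) (f y).
Proof.
move=> x0 xw wy; have [xy|xy] := eqVneq x y.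
  by rewrite -xy maxxx (_ : w = x)//; lra.
have xy0 : 0 < y - x by lra.
pose t := (y - w) / (y - x).
have t0 : 0 <= t by rewrite divr_ge0//; lra.
have t1 : t <= 1 by rewrite ler_pdivrMr//; lra.
have -> : w = t * x + (1 - t) * y by rewrite /t; field; lra.
have t01 : 0 <= t <= 1 by rewrite t0.
apply: le_trans (convex_function_ineq x0 _ t01) _; first lra.
set m := Num.max _ _.
have : f x <= m by rewrite le_max lexx.
have : f y <= m by rewrite le_max lexx orbT.
by nra.
Qed.

Hypothesis f_ge0 : forall x : R, 0 < x -> 0 <= f x.
Hypothesis f1 : f 1 = 0.

Lemma extend_pos (x : R) : 0 < x -> extend f x = (f x)%:E.
Proof. by rewrite /extend => ->. Qed.

Lemma extend_neg (x : R) : x < 0 -> extend f x = +oo%E.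
Proof. by rewrite /extend => x0; rewrite ltNge (ltW x0)/= lt_eqF. Qed.

(** A nonnegative convex function vanishing at 1 is nonincreasing on ]0, 1], so
    its limit at 0 exists and is a supremum. *)
Lemma extend0 : extend f 0 = ereal_sup [set (f x)%:E | x in `]0, 1[ ].
Proof.
rewrite /extend ltxx eqxx; apply/cvg_lim => //.
apply: (nonincreasing_at_right_cvge (BLeft 1)) => /=.
  by rewrite bnd_simp.
move=> x y; rewrite !in_itv/= => /andP[x0 x1] /andP[y0 y1] xy.
rewrite lee_fin; apply: le_trans (convex_function_quasi x0 xy (ltW y1)) _.
by rewrite f1 ge_max lexx/= f_ge0.
Qed.

Lemma le_extend0 (x : R) : 0 < x < 1 -> ((f x)%:E <= extend f 0)%E.
Proof.
move=> x01; rewrite extend0; apply: ereal_sup_ubound => /=.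
by exists x => //=; rewrite in_itv.
Qed.

Lemma extend_ge0 (x : R) : (0 <= extend f x)%E.
Proof.
have [x0|x0|->] := ltgtP x 0.
- by rewrite extend_neg.
- by rewrite extend_pos// lee_fin f_ge0.
- have h : 0 < (2^-1 : R) < 1 by lra.
  by apply: le_trans (le_extend0 h); rewrite lee_fin f_ge0//; case/andP: h.
Qed.

Lemma extend1 : extend f 1 = 0%E.
Proof. by rewrite extend_pos// f1. Qed.

(** Quasiconvexity survives the passage to the limit at 0. It is all of the
    convexity of the extension that is used below: it makes the sublevel sets
    intervals, which gives measurability and the shape of the zero set. *)
Lemma extend_quasi (x w y : R) : x <= w -> w <= y ->
  (extend f w <= maxe (extend f x) (extend f y))%E.
Proof.
move=> xw wy; have [x0|x0|x0] := ltgtP x 0.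
- by rewrite (@extend_neg x)// maxye leey.
- have w0 : 0 < w by lra.
  have y0 : 0 < y by lra.
  by rewrite !extend_pos// -EFin_max lee_fin convex_function_quasi.
- have [<-|xw'] := eqVneq x w; first by rewrite le_max lexx.
  have w0 : 0 < w by lra.
  pose m := Num.min w 1; have m0 : 0 < m by rewrite lt_min w0/=.
  have mw : m <= w by rewrite ge_min lexx.
  have m1 : m <= 1 by rewrite ge_min lexx orbT.
  have h : 0 < m / 2 < 1 by lra.
  rewrite x0 (@extend_pos w)// (@extend_pos y ltac:(lra)).
  apply: (@le_trans _ _ (maxe (f (m / 2))%:E (f y)%:E)).
    rewrite -EFin_max lee_fin convex_function_quasi//; lra.
  rewrite ge_max; apply/andP; split; rewrite le_max ?lexx ?orbT//.
  by rewrite le_extend0.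
Qed.

Lemma extend_eq0_between (x w y : R) : extend f x = 0%E -> extend f y = 0%E ->
  x <= w -> w <= y -> extend f w = 0%E.
Proof.
move=> fx fy xw wy; apply/eqP; rewrite eq_le extend_ge0 andbT.
by have := extend_quasi xw wy; rewrite fx fy maxxx.
Qed.

Lemma measurable_extend : measurable_fun setT (extend f).
Proof.
apply: (measurability (@ErealGenInftyO.G R)) => [|/= _ [_] [r] -> <-].
  exact: ErealGenInftyO.measurableE.
rewrite setTI; apply: is_interval_measurable => x y/=.
rewrite !in_itv/= => fx fy w /andP[xw wy]; rewrite in_itv/=.
by apply: le_lt_trans (extend_quasi xw wy) _; rewrite gt_max fx.
Qed.

(** Zeros of a nonnegative convex function accumulate only at zeros: between a
    zero x near a and one of the points a / 2 and 2 * a lies a, and convexity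
    bounds f a by a multiple of the distance from x to a. *)
Lemma extend_eq0_limit (a : R) : 0 < a ->
  (forall e, 0 < e -> exists x, [/\ 0 < x, `|x - a| < e & f x = 0]) -> f a = 0.
Proof.
move=> a0 hx; apply/eqP; rewrite eq_le f_ge0// andbT leNgt; apply/negP => fa.
(* C bounds the values at both far endpoints; the 1 makes it positive. *)
pose C := f (a / 2) + f (2 * a) + 1.
have h1 : 0 <= f (a / 2) by apply: f_ge0; lra.
have h2 : 0 <= f (2 * a) by apply: f_ge0; lra.
have C0 : 0 < C by rewrite /C; lra.
pose e := f a * (a / 2) / C.
have e0 : 0 < e by rewrite /e divr_gt0// mulr_gt0//; lra.
have eC : e * C = f a * (a / 2) by rewrite /e mulfVK// gt_eqF.
have [x [x0 xa fx]] := hx e e0.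
have key y t : 0 < y -> 0 <= t <= 1 -> a = t * y + (1 - t) * x ->
    f a <= t * f y.
  move=> y0 t01 ->; apply: le_trans (convex_function_ineq y0 x0 t01) _.
  by rewrite fx mulr0 addr0.
have [xa'|ax|xa'] := ltgtP x a; last by rewrite xa' in fx; lra.
- move: xa; rewrite ltr0_norm ?subr_lt0// opprB => xa.
  have d0 : 0 < 2 * a - x by lra.
  have : f a <= (a - x) / (2 * a - x) * f (2 * a).
    apply: key; [lra| |by field; lra].
    by rewrite divr_ge0 ?ler_pdivrMr//; lra.
  rewrite mulrAC ler_pdivlMr// => H.
  have : (a - x) * f (2 * a) <= e * f (2 * a) by rewrite ler_wpM2r// ltW.
  have : f a * a <= f a * (2 * a - x) by rewrite ler_wpM2l ?ltW//; lra.
  move: eC; rewrite /C; nra.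
- move: xa; rewrite gtr0_norm ?subr_gt0// => xa.
  have d0 : 0 < x - a / 2 by lra.
  have : f a <= (x - a) / (x - a / 2) * f (a / 2).
    apply: key; [lra| |by field; lra].
    by rewrite divr_ge0 ?ler_pdivrMr//; lra.
  rewrite mulrAC ler_pdivlMr// => H.
  have : (x - a) * f (a / 2) <= e * f (a / 2) by rewrite ler_wpM2r// ltW.
  have : f a * (a / 2) <= f a * (x - a / 2) by rewrite ler_wpM2l ?ltW//; lra.
  move: eC; rewrite /C; nra.
Qed.

Lemma slope_infty_eq0 : (forall x, 1 <= x -> f x = 0) -> slope_infty f = 0%E.
Proof.
move=> f0; apply/cvg_lim => //; apply: cvg_near_cst.
by near=> x; rewrite f0 ?mul0r//; near: x; exact: nbhs_pinfty_ge.
Unshelve. all: by end_near. Qed.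

(** If the slope at infinity is not zero, f cannot vanish on all of [1, +oo[;
    with quasiconvexity and closedness its zero set is a compact interval. *)
Lemma extend_zero_set : slope_infty f <> 0%E ->
  exists p q, [/\ 0 <= p <= 1, 1 <= q, extend f p = 0%E, extend f q = 0%E &
    forall x, extend f x = 0%E -> p <= x <= q].
Proof.
move=> slope0; pose J := [set x | extend f x = 0%E].
have J1 : J 1 by exact: extend1.
have J0 x : J x -> 0 <= x.
  by rewrite leNgt => Jx; apply/negP => /extend_neg; rewrite Jx.
have Jl : has_lbound J by exists 0.
have [b b1 fb] : exists2 b, 1 <= b & f b <> 0.
  apply: contrapT => /forall2NP hb; apply/slope0/slope_infty_eq0 => x x1.
  by have [//|/contrapT//] := hb x.
have Jb x : J x -> x <= b.
  move=> Jx; rewrite leNgt; apply/negP => bx; apply: fb.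
  have := extend_eq0_between J1 Jx b1 (ltW bx).
  by rewrite extend_pos ?(lt_le_trans _ b1)// => -[].
have Ju : has_ubound J by exists b.
have hs : has_sup J by split => //; exists 1.
have hi : has_inf J by split => //; exists 1.
exists (inf J), (sup J); split.
- by rewrite lb_le_inf//= ?ge_inf//; exists 1.
- exact: ub_le_sup.
- have : 0 <= inf J by apply: lb_le_inf; [exists 1|move=> x /J0].
  rewrite le_eqVlt => /predU1P[i0|i0].
    have z x : 0 < x < 1 -> f x = 0.
      move=> /andP[x0 x1]; have [y Jy] := inf_adherent x0 hi.
      rewrite -i0 add0r => yx.
      have := extend_eq0_between Jy J1 (ltW yx) (ltW x1).
      by rewrite extend_pos// => -[].
    rewrite -i0 extend0; apply/eqP; rewrite eq_le; apply/andP; split.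
      by apply: ge_ereal_sup => _ [x + <-]; rewrite /= in_itv/= => /z ->.
    by rewrite -extend0 extend_ge0.
  rewrite extend_pos//; congr EFin; apply: extend_eq0_limit => // e e0.
  have [y Jy yx] := inf_adherent e0 hi.
  have iy : inf J <= y by exact: ge_inf.
  exists y; split; [lra| |].
    by rewrite ger0_norm; lra.
  by move: Jy; rewrite /J/= extend_pos ?(lt_le_trans i0)// => -[].
- have s1 : 1 <= sup J by exact: ub_le_sup.
  rewrite extend_pos; last lra.
  congr EFin; apply: extend_eq0_limit => [|e e0]; first lra.
  have m0 : 0 < Num.min e (1/2) by rewrite lt_min e0/=; lra.
  have [y Jy yx] := sup_adherent m0 hs.
  have iy : y <= sup J by exact: ub_le_sup.
  have := yx; rewrite ltrBlDr -ltrBlDl lt_min => /andP[yx1 yx2].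
  exists y; split; [lra| |].
    by rewrite ler0_norm; lra.
  by move: Jy; rewrite /J/= extend_pos; [move=> -[]|lra].
- by move=> x Jx; rewrite ge_inf//= ub_le_sup.
Qed.

End convex_facts.

(** * Densities, Lebesgue decompositions and divergences *)

Section density.
Local Open Scope ereal_scope.
Context d (T : measurableType d) (R : realType).
Variables (mu : {finite_measure set T -> \bar R}) (theta : T -> R).
Hypothesis theta_meas : measurable_fun setT theta.
Hypothesis theta_ge0 : forall x, (0 <= theta x)%R.

(** The two proofs are arguments so that the measure structure can be attached
    to this constant. *)
Definition density_measure of measurable_fun setT theta &
    (forall x, (0 <= theta x)%R) : set T -> \bar R :=
  fun A => \int[mu]_(x in A) (theta x)%:E.

Local Notation nu := (density_measure theta_meas theta_ge0).

Let nu0 : nu set0 = 0.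
Proof. exact: integral_set0. Qed.

Let nu_ge0 A : 0 <= nu A.
Proof. by apply: integral_ge0 => x _; rewrite lee_fin. Qed.

Let nu_sigma_additive : semi_sigma_additive nu.
Proof.
move=> F mF tF mUF; rewrite /density_measure ge0_integral_bigcup//.
- apply: (@ereal_nondecreasing_is_cvgn _ _) => m n mn.
  by apply: lee_sum_nneg_natr => // k _ _; exact: nu_ge0.
- exact/measurable_EFinP/measurable_funTS.
- by move=> x _; rewrite lee_fin.
Qed.

HB.instance Definition _ := isMeasure.Build _ _ _ nu nu0 nu_ge0
  nu_sigma_additive.

(** By uniqueness of densities, theta is almost everywhere the Radon-Nikodym
    derivative of the measure it defines, for which the change of variables
    holds. *)
Lemma ge0_integral_density (g : T -> \bar R) :
  mu.-integrable setT (EFin \o theta) ->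
  (forall x, 0 <= g x) -> measurable_fun setT g ->
  \int[nu]_x g x = \int[mu]_x (g x * (theta x)%:E).
Proof.
move=> ith g0 mg.
have nufin : nu setT < +oo.
  have /integrableP[_] := ith.
  by under eq_integral do rewrite /= ger0_norm//.
pose nu1 : {finite_measure set T -> \bar R} := mfrestr measurableT nufin.
have nu1E A : nu1 A = nu A by rewrite /nu1/= /mfrestr /mrestr setIT.
have dom : nu1 `<< mu.
  apply/null_content_dominatesP => A mA A0; rewrite nu1E.
  rewrite /density_measure null_set_integral//.
  exact/measurable_EFinP/measurable_funTS.
have aeE : ae_eq mu setT (Radon_Nikodym_SigmaFinite.f nu1 mu) (EFin \o theta).
  apply: integral_ae_eq => //.
  - exact: Radon_Nikodym_SigmaFinite.f_integrable.
  - exact/measurable_EFinP.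
  - by move=> A _ mA; rewrite -Radon_Nikodym_SigmaFinite.f_integral.
have mf := measurable_int _ (Radon_Nikodym_SigmaFinite.f_integrable dom).
transitivity (\int[nu1]_x g x).
  by apply: eq_measure_integral => A mA _; symmetry; exact: nu1E.
rewrite -(Radon_Nikodym_SigmaFinite.change_of_variables dom)//.
apply: ae_eq_integral => //.
- exact: emeasurable_funM.
- by apply: emeasurable_funM => //; exact/measurable_EFinP.
- by apply: filterS aeE => x /(_ I) xE _; rewrite xE.
Qed.

End density.

Section tilted.
Local Open Scope ereal_scope.
Context d (T : measurableType d) (R : realType).
Variables (mu : {finite_measure set T -> \bar R}) (theta : T -> R) (c : T).
Hypothesis theta_meas : measurable_fun setT theta.
Hypothesis theta_ge0 : forall x, (0 <= theta x)%R.
Hypothesis theta_le1 : \int[mu]_x (theta x)%:E <= 1.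

Lemma defect_ge0 : (0 <= 1 - fine (\int[mu]_x (theta x)%:E))%R.
Proof.
have i0 : 0 <= \int[mu]_x (theta x)%:E.
  by apply: integral_ge0 => x _; rewrite lee_fin.
rewrite subr_ge0 -lee_fin fineK// ge0_fin_numE//.
exact: le_lt_trans theta_le1 (ltry _).
Qed.

(** The mass that theta leaves missing from a probability, put at the point
    c. *)
Definition tilted_atom : {measure set T -> \bar R} :=
  mscale (NngNum defect_ge0) (dirac c).

Lemma tilted_atomT : tilted_atom setT = 1 - \int[mu]_x (theta x)%:E.
Proof.
have i0 : 0 <= \int[mu]_x (theta x)%:E.
  by apply: integral_ge0 => x _; rewrite lee_fin.
rewrite /tilted_atom/= /mscale/= diracT mule1 EFinB fineK//.
by rewrite ge0_fin_numE//; exact: le_lt_trans theta_le1 (ltry _).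
Qed.

Lemma tilted_atom_fin : tilted_atom setT < +oo.
Proof.
rewrite /tilted_atom/= /mscale/= diracT mule1; exact: ltry.
Qed.

Lemma tilted_exists : exists nu : probability T R, forall A, measurable A ->
  nu A = \int[mu]_(x in A) (theta x)%:E + tilted_atom A.
Proof.
pose m : {measure set T -> \bar R} :=
  measure_add (density_measure mu theta_meas theta_ge0) tilted_atom.
have mE A : m A = \int[mu]_(x in A) (theta x)%:E + tilted_atom A.
  by exact: measure_addE.
have mT : m setT = 1.
  rewrite mE tilted_atomT addeC subeK// ge0_fin_numE//.
    exact: le_lt_trans theta_le1 (ltry _).
  by apply: integral_ge0 => x _; rewrite lee_fin.
exists (mnormalize m (dirac c)) => A mA; rewrite -mE.
transitivity ((if (m setT == 0) || (m setT == +oo) then fun U => \d_c U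
  else fun U => m U * (fine (m setT))^-1%:E) A) => //.
by rewrite mT onee_eq0/= invr1 mule1.
Qed.

End tilted.

Section decomposition.
Local Open Scope ereal_scope.
Context {R : realType}.
Implicit Types mu nu : probability (measurableTypeR R) R.

Lemma decomposition_integrable mu nu theta nuperp :
  lebesgue_decomposition mu nu theta nuperp ->
  mu.-integrable setT (EFin \o theta).
Proof.
move=> [mth th0 _ nuE]; apply/integrableP; split; first exact/measurable_EFinP.
under eq_integral do rewrite /= ger0_norm//.
have := probability_setT nu; rewrite nuE// => nu1.
apply: (@le_lt_trans _ _ 1); last exact: ltry.
by rewrite -nu1 leeDl.
Qed.

Lemma ge0_integral_decomposition mu nu theta nuperp (g : R -> \bar R) :
  lebesgue_decomposition mu nu theta nuperp ->
  (forall x, 0 <= g x) -> measurable_fun setT g ->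
  \int[nu]_x g x =
    \int[mu]_x (g x * (theta x)%:E) + \int[nuperp]_x g x.
Proof.
move=> dec g0 mg; have ith := decomposition_integrable dec.
have [mth th0 _ nuE] := dec.
have -> := esym (ge0_integral_density
  (T := measurableTypeR R) mth th0 ith g0 mg).
rewrite -ge0_integral_measure_add//.
apply: eq_measure_integral => A mA _.
rewrite [RHS]measure_addE; exact: nuE.
Qed.

(** Off a mu-null set carrying both singular parts, the two densities integrate
    to nu over every measurable set. *)
Lemma decomposition_uniq mu nu theta1 nuperp1 theta2 nuperp2 :
  lebesgue_decomposition mu nu theta1 nuperp1 ->
  lebesgue_decomposition mu nu theta2 nuperp2 ->
  ae_eq mu setT theta1 theta2 /\ nuperp1 setT = nuperp2 setT.
Proof.
move=> dec1 dec2.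
have i1 := decomposition_integrable dec1.
have i2 := decomposition_integrable dec2.
have [m1 p1 [N1 [mN1 N10 N1c]] E1] := dec1.
have [m2 p2 [N2 [mN2 N20 N2c]] E2] := dec2.
pose N := N1 `|` N2; have mN : measurable N by exact: measurableU.
have N0 : mu N = 0 by rewrite null_set_setU.
have key (theta : R -> R)
    (nuperp : {finite_measure set (measurableTypeR R) -> \bar R}) (N' : set R) :
    measurable_fun setT theta ->
    (forall x, (0 <= theta x)%R) -> measurable N' -> nuperp (~` N') = 0 ->
    N' `<=` N ->
    (forall A, measurable A ->
      nu A = \int[mu]_(x in A) (theta x)%:E + nuperp A) ->
    forall A, measurable A -> \int[mu]_(x in A) (theta x)%:E = nu (A `\` N).
  move=> mth th0 mN' N'c N'N E A mA.
  transitivity (\int[mu]_(x in A `\` N) (theta x)%:E).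
    apply: ge0_negligible_integral => //.
    + exact/measurable_EFinP/measurable_funTS.
    + by move=> x _; rewrite lee_fin.
  rewrite E; last exact: measurableD.
  rewrite [X in _ + X](_ : _ = 0) ?adde0//.
  apply: (@subset_measure0 _ (measurableTypeR R) R nuperp _ (~` N')) => //.
  - exact: measurableD.
  - exact: measurableC.
  - by move=> x [_ Nx] /N'N.
have k1 := key _ _ _ m1 p1 mN1 N1c (@subsetUl _ _ _) E1.
have k2 := key _ _ _ m2 p2 mN2 N2c (@subsetUr _ _ _) E2.
have ae12 : ae_eq mu setT (EFin \o theta1) (EFin \o theta2).
  apply: integral_ae_eq => //; first exact/measurable_EFinP.
  by move=> A _ mA; rewrite k1// k2.
split; first by apply: filterS ae12 => x /(_ I) [xE] _.
have : nu setT = nu setT by [].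
have nuNfin : nu (setT `\` N) \is a fin_num.
  by apply: fin_num_measure; exact: measurableD.
rewrite {1}E1// E2// k2// k1// => /eqP.
by rewrite eq_le !leeD2lE// -eq_le => /eqP.
Qed.

Lemma measurable_eitv0 (rho : \bar R) : measurable (eitv0 rho : set R).
Proof.
apply: is_interval_measurable => x y [x0 xr] [y0 yr] z /andP[xz zy].
split; first exact: le_trans xz.
by apply: le_lt_trans yr; rewrite lee_fin.
Qed.

Lemma probability_setC_eq0 (P : probability (measurableTypeR R) R) A :
  measurable A -> P A = 1 -> P (~` A) = 0.
Proof. by move=> mA PA; rewrite probability_setC// PA subee. Qed.

Lemma ge0_integral_full (P : probability (measurableTypeR R) R) A
    (g : R -> \bar R) : measurable A -> P A = 1 ->
  measurable_fun setT g -> (forall x, 0 <= g x) ->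
  \int[P]_(x in A) g x = \int[P]_x g x.
Proof.
move=> mA PA mg g0.
have mCA : measurable (~` A) by exact: measurableC.
rewrite -[X in integral _ X _]setCK -setTD; symmetry.
by apply: ge0_negligible_integral => //; exact: probability_setC_eq0.
Qed.

(** The value picked in the definition of the divergence may be computed with
    any decomposition at hand. *)
Lemma divergenceE rho f mu nu theta nuperp :
  mu (eitv0 rho) = 1 -> nu (eitv0 rho) = 1 ->
  measurable_fun setT (extend f) -> (forall x, 0 <= extend f x) ->
  lebesgue_decomposition mu nu theta nuperp ->
  divergence rho f mu nu =
    \int[mu]_x extend f (theta x) + slope_infty f * nuperp setT.
Proof.
move=> muD nuD mf f0 dec; have mD := measurable_eitv0 rho.
have Dperp theta' nuperp' : lebesgue_decomposition mu nu theta' nuperp' ->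
    nuperp' (eitv0 rho) = nuperp' setT.
  move=> [mth th0 _ nuE]; rewrite -(setUv (eitv0 rho)) measureU ?setICr//.
    rewrite [X in _ + X](_ : _ = 0) ?adde0//.
    apply/eqP; rewrite eq_le measure_ge0 andbT.
    rewrite -(probability_setC_eq0 mD nuD) nuE ?leeDr//.
      by apply: integral_ge0 => x _; rewrite lee_fin.
    exact: measurableC.
  exact: measurableC.
have [theta2 [nuperp2 [dec2 ->]]] : exists theta' nuperp',
    lebesgue_decomposition mu nu theta' nuperp' /\
    divergence rho f mu nu = \int[mu]_(x in eitv0 rho) extend f (theta' x)
      + slope_infty f * nuperp' (eitv0 rho).
  apply: (@getPex _ (fun e => exists theta' nuperp',
    lebesgue_decomposition mu nu theta' nuperp' /\
    e = \int[mu]_(x in eitv0 rho) extend f (theta' x)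
      + slope_infty f * nuperp' (eitv0 rho))).
  have [th [np h]] := lebesgue_decomposition_exists mu nu.
  by exists (\int[mu]_(x in eitv0 rho) extend f (th x)
        + slope_infty f * np (eitv0 rho)), th, np.
have [ae12 perp12] := decomposition_uniq dec dec2.
rewrite (Dperp _ _ dec2) -perp12; congr (_ + _).
have [m1 _ _ _] := dec; have [m2 _ _ _] := dec2.
rewrite ge0_integral_full//; last exact: measurableT_comp.
apply: ae_eq_integral => //; [exact: measurableT_comp..|].
by apply: filterS ae12 => x /(_ I) xE _; rewrite xE.
Qed.

End decomposition.

Section tilted_decomposition.
Local Open Scope ereal_scope.
Context {R : realType}.

(** As mu does not charge c, the atom added at c is the singular part of the
    measure so obtained, and theta its density. *)
Lemma tilted_decomposition (mu : probability (measurableTypeR R) R)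
    (theta : R -> R) (c : R) :
  measurable_fun setT theta -> (forall x, (0 <= theta x)%R) ->
  \int[mu]_x (theta x)%:E <= 1 -> mu [set c] = 0 ->
  exists (nu : probability (measurableTypeR R) R) nuperp,
    lebesgue_decomposition mu nu theta nuperp /\
    forall A : set R, nuperp A = (1 - \int[mu]_x (theta x)%:E) * \d_c A.
Proof.
move=> mth th0 th1 muc.
have [nu nuE] := tilted_exists (T := measurableTypeR R) c mth th0 th1.
have atomE (A : set R) : tilted_atom (T := measurableTypeR R) c th0 th1 A =
    (1 - \int[mu]_x (theta x)%:E) * \d_c A.
  rewrite -(tilted_atomT (T := measurableTypeR R) c th0 th1).
  by rewrite /tilted_atom/= /mscale/= diracT mule1.
pose nuperp : {finite_measure set (measurableTypeR R) -> \bar R} :=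
  mfrestr measurableT (tilted_atom_fin (T := measurableTypeR R) c th0 th1).
have perpE (A : set R) : nuperp A = (1 - \int[mu]_x (theta x)%:E) * \d_c A.
  by rewrite -atomE /nuperp/= /mfrestr /mrestr setIT.
exists nu, nuperp; split => //; split => //.
- exists [set c]; split => //.
  by rewrite perpE diracE memNset ?mule0//=; exact.
- by move=> A mA; rewrite nuE// perpE atomE.
Qed.

End tilted_decomposition.

(** * The Neyman-Pearson lemma *)

Section bounded_integrands.
Context d (T : measurableType d) (R : realType) (P : probability T R).

Lemma le_integrableR (f g : T -> R) : measurable_fun setT f ->
  (forall x, `|f x| <= g x) -> P.-integrable setT (EFin \o g) ->
  P.-integrable setT (EFin \o f).
Proof.
move=> mf fg; apply: le_integrable => //; first exact/measurable_EFinP.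
by move=> x _ /=; rewrite lee_fin (le_trans (fg x))// ler_norm.
Qed.

Lemma integrable_cstR (k : R) : P.-integrable setT (EFin \o fun=> k).
Proof. exact: finite_measure_integrable_cst. Qed.

Lemma integrableZlR (k : R) (f : T -> R) : P.-integrable setT (EFin \o f) ->
  P.-integrable setT (EFin \o fun x => k * f x).
Proof. exact: integrableZl. Qed.

Lemma integrableDR (f g : T -> R) : P.-integrable setT (EFin \o f) ->
  P.-integrable setT (EFin \o g) ->
  P.-integrable setT (EFin \o fun x => f x + g x).
Proof. exact: integrableD. Qed.

Lemma integrableBR (f g : T -> R) : P.-integrable setT (EFin \o f) ->
  P.-integrable setT (EFin \o g) ->
  P.-integrable setT (EFin \o fun x => f x - g x).
Proof. exact: integrableB. Qed.

Lemma Rintegral_cst1 (k : R) : \int[P]_x k = k.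
Proof.
rewrite Rintegral_cst//; transitivity (k * fine 1%E); last exact: mulr1.
by congr (_ * fine _); exact: probability_setT.
Qed.

Lemma Rintegral_indic (A : set T) : measurable A ->
  \int[P]_x (\1_A x : R) = fine (P A).
Proof. by move=> mA; rewrite /Rintegral integral_indic// setIT. Qed.

End bounded_integrands.

Section neyman_pearson.
Context d (T : measurableType d) (R : realType) (P : probability T R).
Variable h : T -> R.
Hypothesis h_meas : measurable_fun setT h.
Hypothesis h_ge0 : forall x, 0 <= h x.

Let below (s : R) : set T := [set x | h x < s].

Let mbelow s : measurable (below s).
Proof.
have -> : below s = setT `&` h @^-1` `]-oo, s[.
  by apply/seteqP; split => x; rewrite /below/= in_itv/= => // -[].
exact: h_meas.
Qed.

Let le_below s t : s <= t -> (P (below s) <= P (below t))%E.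
Proof.
move=> st; apply: le_measure; rewrite ?inE//; try exact: mbelow.
by move=> x; rewrite /below/= => /lt_le_trans; apply.
Qed.

(** Take for s the supremum of the levels with mass at most tau strictly below
    them; continuity of the measure from below and from above gives the two
    inequalities. *)
Lemma quantile_exists (tau : R) : 0 <= tau < 1 -> exists s,
  [/\ measurable [set x | h x < s], measurable [set x | h x = s],
      (P [set x | (h x < s)%R] <= tau%:E)%E &
      (tau%:E <= P [set x | (h x < s)%R] + P [set x | h x = s])%E].
Proof.
move=> /andP[tau0 tau1].
pose A := [set s | (P (below s) <= tau%:E)%E].
have A0 : A 0.
  rewrite /A/= (_ : below 0 = set0) ?measure0//.
  by apply/seteqP; split => x //; rewrite /below/= ltNge h_ge0.
have [b Ab] : exists b, ~ A b.
  apply: contrapT => /forallNP nA.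
  have : (1 <= tau%:E)%E.
    rewrite -(probability_setT P).
    have -> : setT = \bigcup_n below n%:R.
      apply/seteqP; split => // x _; exists (Num.trunc (h x)).+1 => //.
      exact: truncnS_gt.
    have cv : (P \o (fun n => below n%:R)) n @[n --> \oo] -->
        P (\bigcup_n below n%:R).
      apply: nondecreasing_cvg_mu => //; first exact: bigcupT_measurable.
      move=> m n mn; apply/subsetPset => x; rewrite /below/= => /lt_le_trans.
      by apply; rewrite ler_nat.
    rewrite -(cvg_lim _ cv)//; apply: lime_le.
      by apply/cvg_ex; eexists; exact: cv.
    by near=> n; have /contrapT := nA n%:R.
  by rewrite lee_fin leNgt tau1.
have Aub x : A x -> x <= b.
  by move=> Ax; rewrite leNgt; apply/negP => /ltW/le_below/le_trans/(_ Ax).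
have hs : has_sup A by split; [exists 0|exists b].
pose s := sup A; exists s.
have mle : measurable [set x | h x <= s].
  have -> : [set x | h x <= s] = setT `&` h @^-1` `]-oo, s].
    by apply/seteqP; split => x; rewrite /below/= in_itv/= => // -[].
  exact: h_meas.
have meq : measurable [set x | h x = s].
  have -> : [set x | h x = s] = setT `&` h @^-1` [set s].
    by apply/seteqP; split => x //= -[].
  exact: h_meas.
have n1 (n : nat) : 0 < n.+1%:R^-1 :> R by rewrite invr_gt0.
have mlt : measurable [set x | h x < s] := mbelow s.
split => //.
- have -> : [set x | h x < s] = \bigcup_n below (s - n.+1%:R^-1).
    apply/seteqP; split => x; rewrite /below/=.
      move=> xs; have xs0 : 0 < s - h x by lra.
      near \oo => n; exists n => //=; rewrite ltrBrDl -ltrBrDr.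
      near: n; exact: near_infty_natSinv_lt (PosNum xs0).
    by move=> [n _] /lt_trans; apply; rewrite gtrBl.
  have cv : (P \o (fun n : nat => below (s - n.+1%:R^-1))) n @[n --> \oo] -->
      P (\bigcup_n below (s - n.+1%:R^-1)).
    apply: nondecreasing_cvg_mu => //.
    + by apply: bigcupT_measurable => n; exact: mbelow.
    + move=> m n mn; apply/subsetPset => x; rewrite /below/= => /lt_le_trans.
      by apply; rewrite lerB// lef_pV2 ?posrE// ler_nat.
  rewrite -(cvg_lim _ cv)//; apply: lime_le.
    by apply/cvg_ex; eexists; exact: cv.
  near=> n; have [t At st] := sup_adherent (n1 n) hs.
  exact: le_trans (le_below (ltW st)) At.
- rewrite -measureU//; first last.
    by apply/seteqP; split => x //= -[xs xs']; rewrite xs' ltxx in xs.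
  have -> : [set x | h x < s] `|` [set x | h x = s] =
      \bigcap_n below (s + n.+1%:R^-1).
    apply/seteqP; split => x /=.
      move=> xs n _; rewrite /below/= (@le_lt_trans _ _ s)//.
        by case: xs => [/ltW|->].
      by rewrite ltrDl.
    move=> xs; have : h x <= s.
      rewrite leNgt; apply/negP => sx; have sx0 : 0 < h x - s by lra.
      near \oo => n; have := xs n Logic.I.
      rewrite /below/= ltNge => /negP; apply.
      rewrite -lerBrDl; apply: ltW; near: n.
      exact: near_infty_natSinv_lt (PosNum sx0).
    by rewrite le_eqVlt => /predU1P[]; [right|left].
  suff H : (tau%:E <= P (\bigcap_n below (s + n.+1%:R^-1)))%E by exact: H.
  have cv : (P \o (fun n : nat => below (s + n.+1%:R^-1))) n @[n --> \oo] -->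
      P (\bigcap_n below (s + n.+1%:R^-1)).
    apply: nonincreasing_cvg_mu => //.
    + exact: le_lt_trans (probability_le1 _ (mbelow _)) (ltry _).
    + by apply: bigcapT_measurable => n; exact: mbelow.
    + move=> m n mn; apply/subsetPset => x; rewrite /below/= => /lt_le_trans.
      by apply; rewrite lerD2l lef_pV2 ?posrE// ler_nat.
  rewrite -(cvg_lim _ cv)//; apply: lime_ge.
    by apply/cvg_ex; eexists; exact: cv.
  near=> n; rewrite leNgt; apply/negP => /ltW An.
  have := ub_le_sup hs.2 An; rewrite -/s leNgt => /negP; apply.
  by rewrite ltrDl.
Unshelve. all: by end_near. Qed.

(** Among the functions with values in [0, 1] and integral tau, the one that
    charges the lowest levels of h has the least h-moment: it is 1 below the
    quantile s and 0 above it, hence (psi - phi) * (h - s) >= 0 pointwise for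
    any competitor psi, and the integral of psi - phi is zero. *)
Lemma neyman_pearson (tau : R) : P.-integrable setT (EFin \o h) ->
  0 <= tau < 1 -> exists phi : T -> R,
  [/\ measurable_fun setT phi, forall x, 0 <= phi x <= 1,
      forall x y, h x < h y -> phi y <= phi x, \int[P]_x phi x = tau &
      forall psi : T -> R, measurable_fun setT psi ->
        (forall x, 0 <= psi x <= 1) -> \int[P]_x psi x = tau ->
        \int[P]_x (phi x * h x) <= \int[P]_x (psi x * h x)].
Proof.
move=> ih tau01; have [s [mA mB Atau tauAB]] := quantile_exists tau01.
set A := [set x | h x < s] in mA Atau tauAB.
set B := [set x | h x = s] in mB tauAB.
have PA : P A = (fine (P A))%:E by rewrite fineK// fin_num_measure.
have PB : P B = (fine (P B))%:E by rewrite fineK// fin_num_measure.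
rewrite PA PB -?EFinD !lee_fin in Atau tauAB.
have b0 : 0 <= fine (P B) by rewrite fine_ge0.
set a := fine (P A) in Atau tauAB; set b := fine (P B) in tauAB b0.
(* The level h = s may be an atom: the weight g makes up the missing mass. *)
pose g := if b == 0 then 0 else (tau - a) / b.
have [g01 gE] : 0 <= g <= 1 /\ a + g * b = tau.
  rewrite /g; case: eqVneq => [b0'|bn0]; first by split; lra.
  have b0' : 0 < b by rewrite lt_neqAle eq_sym bn0.
  split; last by field.
  by rewrite divr_ge0 ?ler_pdivrMr//; lra.
pose phi x : R := \1_A x + g * \1_B x.
have phiA x : h x < s -> phi x = 1.
  move=> xs; rewrite /phi !indicE mem_set// memNset ?mulr0 ?addr0//.
  by rewrite /B/= => xs'; rewrite xs' ltxx in xs.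
have phiB x : h x = s -> phi x = g.
  move=> xs; rewrite /phi !indicE (mem_set (xs : B x)) memNset ?mulr1 ?add0r//.
  by rewrite /A/= xs ltxx.
have phiC x : s < h x -> phi x = 0.
  move=> xs; rewrite /phi !indicE !memNset ?mulr0 ?addr0//.
    by rewrite /B/= => xs'; rewrite xs' ltxx in xs.
  by rewrite /A/= ltNge (ltW xs).
have mphi : measurable_fun setT phi.
  apply: measurable_funD; first exact: measurable_indic.
  by apply: measurable_funM => //; exact: measurable_indic.
have phi01 x : 0 <= phi x <= 1.
  by have [/phiA ->|/phiC ->|/phiB ->//] := ltgtP (h x) s; rewrite ?lexx ?ler01.
have bounded_int (psi : T -> R) : measurable_fun setT psi ->
    (forall x, 0 <= psi x <= 1) -> P.-integrable setT (EFin \o psi).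
  move=> mpsi psi01; apply: (le_integrableR (g := fun=> 1)) => //.
    by move=> x; have /andP[? ?] := psi01 x; rewrite ger0_norm.
  exact: integrable_cstR.
have boundedh_int (psi : T -> R) : measurable_fun setT psi ->
    (forall x, 0 <= psi x <= 1) ->
    P.-integrable setT (EFin \o (fun x => psi x * h x)).
  move=> mpsi psi01; apply: (le_integrableR (g := h)) => //.
    exact: measurable_funM.
  move=> x; have /andP[p0 p1] := psi01 x; have hx := h_ge0 x.
  by rewrite ger0_norm ?mulr_ge0//; nra.
have phiint : \int[P]_x phi x = tau.
  have mI (C : set T) : measurable C ->
      P.-integrable setT (EFin \o (\1_C : T -> R)).
    move=> mC; apply: bounded_int; first exact: measurable_indic.
    by move=> x; rewrite indicE; case: (_ \in _); rewrite /= ?lexx ?ler01.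
  rewrite /phi RintegralD//; [|exact: mI|by apply: integrableZlR; exact: mI].
  rewrite RintegralZl//; last exact: mI.
  by rewrite !Rintegral_indic.
exists phi; split => //.
  move=> x y xy; have /andP[px0 px1] := phi01 x; have /andP[py0 py1] := phi01 y.
  have [xs|xs|xs] := ltgtP (h x) s.
  - by rewrite (phiA x).
  - by rewrite (phiC y) ?(lt_trans xs).
  - by rewrite (phiC y) -?xs.
move=> psi mpsi psi01 psiint.
have iphi := bounded_int _ mphi phi01; have ipsi := bounded_int _ mpsi psi01.
have iphih := boundedh_int _ mphi phi01.
have ipsih := boundedh_int _ mpsi psi01.
have : \int[P]_x (s * (psi x - phi x)) <= \int[P]_x (psi x * h x - phi x * h x).
  apply: le_Rintegral => //.
  - by apply: integrableZlR; exact: integrableBR.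
  - exact: integrableBR.
  - move=> x _; have /andP[p0 p1] := psi01 x.
    by have [xs|xs|xs] := ltgtP (h x) s;
      [rewrite (phiA x xs)|rewrite (phiC x xs)|rewrite xs]; nra.
rewrite RintegralZl//; last exact: integrableBR.
by rewrite !RintegralB// psiint phiint subrr mulr0 subr_ge0.
Qed.

End neyman_pearson.

(** * Almost everywhere comparison of integrals *)

Section ae_Rintegral.
Context d (T : measurableType d) (R : realType) (P : probability T R).

Lemma ae_eq_Rintegral (f g : T -> R) :
  measurable_fun setT f -> measurable_fun setT g ->
  {ae P, forall x, f x = g x} -> \int[P]_x f x = \int[P]_x g x.
Proof.
move=> mf mg fg; rewrite /Rintegral; congr fine; apply: ae_eq_integral => //.
- exact/measurable_EFinP.
- exact/measurable_EFinP.
- by apply: filterS fg => x fgx _; rewrite fgx.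
Qed.

Lemma integrable_measurableR (f : T -> R) :
  P.-integrable setT (EFin \o f) -> measurable_fun setT f.
Proof. by move=> /measurable_int /measurable_EFinP. Qed.

Lemma ae_le_Rintegral (f g : T -> R) :
  P.-integrable setT (EFin \o f) -> P.-integrable setT (EFin \o g) ->
  {ae P, forall x, f x <= g x} -> \int[P]_x f x <= \int[P]_x g x.
Proof.
move=> fi gi fg; rewrite -subr_ge0 -RintegralB//.
have gfi := integrableBR gi fi.
rewrite (ae_eq_Rintegral (g := fun x => `|g x - f x|)).
- by apply: Rintegral_ge0 => x _; exact: normr_ge0.
- exact: integrable_measurableR.
- by apply: measurableT_comp => //; exact: integrable_measurableR.
- by apply: filterS fg => x fgx; rewrite ger0_norm// subr_ge0.
Qed.

Lemma Rintegral_eq0_ae (f : T -> R) : P.-integrable setT (EFin \o f) ->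
  {ae P, forall x, 0 <= f x} -> \int[P]_x f x = 0 -> {ae P, forall x, f x = 0}.
Proof.
move=> fi f0 if0; have mf := integrable_measurableR fi.
have : ae_eq P setT (EFin \o f) (cst 0%E).
  apply/ae_eq_integral_abs => //; first exact/measurable_EFinP.
  have fin : (\int[P]_x `|(EFin \o f) x|)%E \is a fin_num.
    by apply: integrable_fin_num => //; exact: integrable_abse.
  rewrite -(fineK fin); congr EFin; rewrite -[RHS]if0.
  apply: (ae_eq_Rintegral (f := fun x => `|f x|)) => //.
    exact: measurableT_comp.
  by apply: filterS f0 => x fx; rewrite ger0_norm.
by apply: filterS => x /(_ I) [].
Qed.

(** A nonnegative extended function with finite integral is, almost everywhere,
    its own real part. *)
Lemma fine_integrable (g : T -> \bar R) : measurable_fun setT g ->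
  (forall x, 0 <= g x)%E -> (\int[P]_x g x < +oo)%E ->
  [/\ P.-integrable setT (EFin \o (fine \o g)),
      {ae P, forall x, g x = (fine (g x))%:E} &
      (\int[P]_x g x)%E = (\int[P]_x fine (g x))%:E].
Proof.
move=> mg g0 goo.
have gi : P.-integrable setT g.
  apply/integrableP; split => //.
  by under eq_integral do rewrite gee0_abs//.
have gae : {ae P, forall x, g x = (fine (g x))%:E}.
  have := integrable_ae measurableT gi.
  by apply: filterS => x /(_ I) gx; rewrite fineK.
have mfg : measurable_fun setT (fine \o g).
  apply: (measurableT_comp _ mg); exact: measurable_realfun.fine_measurable.
have gE : (\int[P]_x g x = \int[P]_x (fine (g x))%:E)%E.
  apply: ae_eq_integral => //; first exact/measurable_EFinP.
  by apply: filterS gae => x gx _.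
split => //; last first.
  by rewrite [RHS]fineK -gE// ge0_fin_numE// integral_ge0.
apply/integrableP; split; first exact/measurable_EFinP.
under eq_integral do rewrite /= ger0_norm ?fine_ge0//.
by rewrite -gE.
Qed.

End ae_Rintegral.

Lemma ae_imply d (T : measurableType d) (R : realType) (P : probability T R)
    (A B : T -> Prop) : (forall x, A x -> B x) ->
  {ae P, forall x, A x} -> {ae P, forall x, B x}.
Proof. by move=> AB; apply: filterS. Qed.

Lemma ae_imply2 d (T : measurableType d) (R : realType) (P : probability T R)
    (A B C : T -> Prop) : (forall x, A x -> B x -> C x) ->
  {ae P, forall x, A x} -> {ae P, forall x, B x} -> {ae P, forall x, C x}.
Proof. by move=> ABC; apply: filterS2. Qed.

Lemma EFin_Rintegral d (T : measurableType d) (R : realType)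
    (P : probability T R) (g : T -> R) : P.-integrable setT (EFin \o g) ->
  (\int[P]_x (g x)%:E)%E = (\int[P]_x g x)%:E.
Proof.
by move=> gi; rewrite /Rintegral fineK//; exact: integrable_fin_num gi.
Qed.

(** * Optimality by convex duality *)

Section duality.
Context d (T : measurableType d) (R : realType) (mu : probability T R).
Variables (f : R -> R) (alpha : R).
Hypothesis f_convex : @convex_function R R^o `]0, +oo[%classic f.
Hypothesis f_ge0 : forall x : R, 0 < x -> 0 <= f x.
Hypothesis f1 : f 1 = 0.
Variables (h : T -> R) (kappa : R).
Hypothesis h_ge0 : forall x, 0 <= h x.
Hypothesis h_int : mu.-integrable setT (EFin \o h).
Variables (theta : T -> R) (lambda eta : R).
Hypothesis theta_int : mu.-integrable setT (EFin \o theta).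
Hypothesis htheta_int : mu.-integrable setT (EFin \o fun x => theta x * h x).
Hypothesis lambda_ge0 : 0 <= lambda.
Hypothesis theta_subgrad : {ae mu, forall x,
  subdifferential f (theta x) (alpha - lambda - eta * h x)}.
Hypothesis theta_moment : \int[mu]_x (theta x * h x) = kappa.
Hypothesis slackness : lambda * (\int[mu]_x theta x - 1) = 0.

Let fext_ge0 x : (0 <= extend f x)%E := extend_ge0 f_convex f_ge0 f1 x.
Let fext_meas : measurable_fun setT (extend f) :=
  measurable_extend f_convex f_ge0 f1.

Let z x := alpha - lambda - eta * h x.

Let z_int (g : T -> R) : mu.-integrable setT (EFin \o g) ->
  mu.-integrable setT (EFin \o fun x => g x * h x) ->
  mu.-integrable setT (EFin \o fun x => z x * g x) /\
  \int[mu]_x (z x * g x) =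
    (alpha - lambda) * \int[mu]_x g x - eta * \int[mu]_x (g x * h x).
Proof.
move=> ig igh.
have zE : (fun x => z x * g x) =
    (fun x => (alpha - lambda) * g x - eta * (g x * h x)).
  by apply/funext => x; rewrite /z; ring.
have i1 := integrableZlR (alpha - lambda) ig.
have i2 := integrableZlR eta igh.
rewrite zE; split; first exact: integrableBR.
by rewrite RintegralB// !RintegralZl.
Qed.

Let mtheta := integrable_measurableR theta_int.

Let one_h_int : mu.-integrable setT (EFin \o fun x => 1 * h x).
Proof. by have := integrableZlR 1 h_int. Qed.

(** The subgradient inequality at theta, tested at the point 1 where f vanishes,
    bounds f (theta x) by a linear expression in theta. Integrating it shows that
    theta has finite cost, and that eta is nonnegative when the moment of h under
    mu exceeds kappa. *)
Lemma optimal_density_cost :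
  [/\ mu.-integrable setT (EFin \o (fine \o (extend f \o theta))),
      {ae mu, forall x, extend f (theta x) = (fine (extend f (theta x)))%:E},
      (\int[mu]_x extend f (theta x))%E =
        (\int[mu]_x fine (extend f (theta x)))%:E &
      \int[mu]_x fine (extend f (theta x)) + alpha * (1 - \int[mu]_x theta x)
        <= eta * (\int[mu]_x h x - kappa)].
Proof.
have ptw : {ae mu, forall x,
    (extend f (theta x) <= (z x * theta x - z x * 1)%:E)%E}.
  apply: filterS theta_subgrad => x [fx /(_ 1)].
  rewrite (extend1 f1); have := fext_ge0 (theta x); move: fx.
  case: (extend f _) => [r| |]//= _ _.
  by rewrite -EFinD !lee_fin /z; lra.
have [zti ztE] := z_int theta_int htheta_int.
have [z1i z1E] := z_int (integrable_cstR mu 1) one_h_int.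
have bi := integrableBR zti z1i.
have mft : measurable_fun setT (extend f \o theta).
  by apply: measurableT_comp.
have [Fi Fae FE] :
  [/\ mu.-integrable setT (EFin \o (fine \o (extend f \o theta))),
    {ae mu, forall x, extend f (theta x) = (fine (extend f (theta x)))%:E} &
    (\int[mu]_x extend f (theta x))%E =
      (\int[mu]_x fine (extend f (theta x)))%:E].
  apply: fine_integrable => //=.
  have /integrableP[mb] := bi; apply: le_lt_trans.
  apply: ae_ge0_le_integral => //.
  - exact: measurableT_comp.
  - apply: filterS ptw => x ptwx _; apply: le_trans ptwx _.
    by rewrite /= lee_fin ler_norm.
split => //.
have : \int[mu]_x fine (extend f (theta x)) <=
    \int[mu]_x (z x * theta x - z x * 1).
  apply: ae_le_Rintegral => //.
  apply: filterS2 Fae ptw => x Fx; rewrite {1}Fx lee_fin; exact.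
rewrite RintegralB// ztE z1E Rintegral_cst1 theta_moment.
rewrite (_ : \int[mu]_x (1 * h x) = \int[mu]_x h x); last first.
  by apply: eq_Rintegral => x _; rewrite mul1r.
move: slackness; lra.
Qed.

(** A competitor has density theta' and singular mass s, which costs alpha * s.
    Integrate the subgradient inequality
    f (theta') >= f (theta) + z * (theta' - theta), z = alpha - lambda - eta * h:
    moving mass from the density to the singular part changes the right-hand side
    by alpha - z = lambda + eta * h, which is nonnegative, so that singular mass
    gains nothing. Only an upper bound on the moment of theta' is needed, since
    the singular part may carry the rest. *)
Lemma optimal_density_lower_bound (theta' : T -> R) (s : R) : 0 <= eta ->
  measurable_fun setT theta' -> (forall x, 0 <= theta' x) ->
  (\int[mu]_x (theta' x)%:E = (1 - s)%:E)%E -> 0 <= s ->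
  (\int[mu]_x (theta' x * h x)%:E <= kappa%:E)%E ->
  (\int[mu]_x extend f (theta x) + (alpha * (1 - \int[mu]_x theta x))%:E
    <= \int[mu]_x extend f (theta' x) + (alpha * s)%:E)%E.
Proof.
move=> eta_ge0 mth' th'0 th'1 s0 th'h.
have i0 : (0 <= \int[mu]_x extend f (theta' x))%E by exact: integral_ge0.
have [->|fin] := eqVneq (\int[mu]_x extend f (theta' x))%E +oo%E.
  by rewrite addye// leey.
have mft : measurable_fun setT (extend f \o theta').
  by apply: measurableT_comp.
have [|Fi' Fae' FE'] := fine_integrable (P := mu) mft (fun x => fext_ge0 _).
  by rewrite lt_neqAle fin leey.
have [Fi Fae FE _] := optimal_density_cost.
rewrite /= in FE'; rewrite FE FE' -!EFinD lee_fin.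
have intR (g : T -> R) : measurable_fun setT g -> (forall x, 0 <= g x) ->
    (\int[mu]_x (g x)%:E < +oo)%E ->
    mu.-integrable setT (EFin \o g) /\
    (\int[mu]_x (g x)%:E)%E = (\int[mu]_x g x)%:E.
  move=> mg g0 goo.
  have mEg : measurable_fun setT (EFin \o g) by exact/measurable_EFinP.
  by have [] := fine_integrable mEg (fun x => g0 x) goo.
have [|ti' tE'] := intR theta' mth' th'0; first by rewrite th'1 ltry.
have mh := integrable_measurableR h_int.
have [|||hi' hE'] := intR (fun x => theta' x * h x).
- exact: measurable_funM.
- by move=> x; rewrite mulr_ge0.
- exact: le_lt_trans th'h (ltry _).
have {}th'1 : \int[mu]_x theta' x = 1 - s by move: th'1; rewrite tE' => -[].
rewrite hE' lee_fin in th'h.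
have [zti ztE] := z_int theta_int htheta_int.
have [zti' ztE'] := z_int ti' hi'.
have bi := integrableBR zti' zti.
have : \int[mu]_x (fine (extend f (theta x)) + (z x * theta' x - z x * theta x))
    <= \int[mu]_x fine (extend f (theta' x)).
  apply: ae_le_Rintegral => //; first exact: integrableDR.
  apply: filterS3 Fae Fae' theta_subgrad => x Fx; rewrite /= => Fx'.
  move=> [_ /(_ (theta' x))].
  by rewrite Fx Fx' -EFinD lee_fin /= /z; lra.
rewrite RintegralD// RintegralB// ztE ztE' theta_moment th'1.
have : 0 <= lambda * s by rewrite mulr_ge0.
have : eta * \int[mu]_x (theta' x * h x) <= eta * kappa by rewrite ler_wpM2l.
move: slackness; nra.
Qed.

(** The subdifferential is a monotone relation, and the prescribed subgradient
    decreases strictly with h when eta > 0. *)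
Lemma optimal_density_monotone : 0 < eta ->
  exists N, [/\ measurable N, mu N = 0%E &
    forall x y, ~ N x -> ~ N y -> h x < h y -> theta y <= theta x].
Proof.
move=> eta0; have [N [mN N0 Nsub]] := theta_subgrad.
exists N; split => // x y Nx Ny hxy.
have {}Nx : subdifferential f (theta x) (alpha - lambda - eta * h x).
  by apply: contrapT => /Nsub.
have {}Ny : subdifferential f (theta y) (alpha - lambda - eta * h y).
  by apply: contrapT => /Nsub.
case: Nx => fx /(_ (theta y)); case: Ny => fy /(_ (theta x)).
have := fext_ge0 (theta x); have := fext_ge0 (theta y); move: fx fy.
case: (extend f (theta x)) => [r| |]//= _.
case: (extend f (theta y)) => [r'| |]//= _ _ _.
rewrite -!EFinD !lee_fin => H1 H2; rewrite leNgt; apply/negP => lt.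
have : 0 < eta * (h y - h x) * (theta y - theta x).
  by rewrite !mulr_gt0// subr_gt0.
by move: H1 H2; lra.
Qed.

End duality.

(** * Monotone optimal densities *)

Section rearrangement.
Context d (T : measurableType d) (R : realType) (mu : probability T R).
Variables (f : R -> R).
Hypothesis f_convex : @convex_function R R^o `]0, +oo[%classic f.
Hypothesis f_ge0 : forall x : R, 0 < x -> 0 <= f x.
Hypothesis f1 : f 1 = 0.
Variables (h : T -> R) (kappa : R).
Hypothesis h_ge0 : forall x, 0 <= h x.
Hypothesis h_int : mu.-integrable setT (EFin \o h).
Hypothesis kappa_ge0 : 0 <= kappa.
Hypothesis kappa_lt : kappa < \int[mu]_x h x.
Variable theta : T -> R.
Hypothesis theta_int : mu.-integrable setT (EFin \o theta).
Hypothesis htheta_int : mu.-integrable setT (EFin \o fun x => theta x * h x).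
Hypothesis theta_moment : \int[mu]_x (theta x * h x) = kappa.
Hypothesis theta_zero : {ae mu, forall x, extend f (theta x) = 0%E}.

Let mh := integrable_measurableR h_int.
Let mtheta := integrable_measurableR theta_int.

(** The quotient is the h-weighted average of theta, so theta takes values at
    most equal to it; it is at most 1, so it lies between two zeros of f. *)
Lemma weighted_average_zero : extend f (kappa / \int[mu]_x h x) = 0%E.
Proof.
set H := \int[mu]_x h x; have kH : kappa < H := kappa_lt; set k := kappa / H.
have H0 : 0 < H by exact: le_lt_trans kH.
have k1 : k <= 1 by rewrite ler_pdivrMr// mul1r ltW.
have [[x [fx xk]]|nx] :=
    pselect (exists x, extend f (theta x) = 0%E /\ theta x <= k).
  exact: (extend_eq0_between f_convex f_ge0 f1 fx (extend1 f1) xk k1).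
have gt_k : {ae mu, forall x, k < theta x}.
  apply: filterS theta_zero => x fx; rewrite ltNge; apply/negP => xk.
  by apply: nx; exists x.
pose g x := theta x * h x - k * h x.
have gi : mu.-integrable setT (EFin \o g).
  by apply: integrableBR => //; exact: integrableZlR.
have g0 : {ae mu, forall x, 0 <= g x}.
  apply: filterS gt_k => x /ltW xk; rewrite /g -mulrBl mulr_ge0//.
  by rewrite subr_ge0.
have ig0 : \int[mu]_x g x = 0.
  rewrite /g RintegralB//; last exact: integrableZlR.
  by rewrite RintegralZl// theta_moment /k mulfVK ?subrr// gt_eqF.
have h0 : {ae mu, forall x, h x = 0}.
  apply: filterS2 gt_k (Rintegral_eq0_ae gi g0 ig0) => x xk.
  by rewrite /g -mulrBl => /eqP; rewrite mulf_eq0 subr_eq0 gt_eqF//= => /eqP.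
have : H = 0.
  rewrite /H (ae_eq_Rintegral (g := fun=> 0))// Rintegral_cst1//.
by move=> H00; rewrite H00 ltxx in H0.
Qed.

(** The zero set of f is an interval [p, q], and theta is a density with values
    in it. The monotone density with values p and q given by the Neyman-Pearson
    lemma has a moment at most that of theta, whereas the constant density 1 has
    a larger one; both have values in [p, q], and so has the mixture of the two
    with moment exactly kappa. *)
Lemma zero_density_rearrangement : slope_infty f <> 0%E ->
  \int[mu]_x theta x = 1 -> exists theta' : T -> R,
  [/\ measurable_fun setT theta', forall x, extend f (theta' x) = 0%E,
      forall x, 0 <= theta' x,
      forall x y, h x < h y -> theta' y <= theta' x &
      [/\ mu.-integrable setT (EFin \o theta'), \int[mu]_x theta' x = 1,
          mu.-integrable setT (EFin \o fun x => theta' x * h x) &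
          \int[mu]_x (theta' x * h x) = kappa]].
Proof.
move=> slope0 theta1; set H := \int[mu]_x h x.
have kH : kappa < H := kappa_lt.
have [p [q [/andP[p0 p1] q1 fp fq pq]]] :=
  extend_zero_set f_convex f_ge0 f1 slope0.
have thpq : {ae mu, forall x, p <= theta x <= q}.
  by apply: filterS theta_zero => x /pq.
have q_gt1 : 1 < q.
  rewrite lt_neqAle q1 andbT; apply/negP => /eqP q1E.
  have gi := integrableBR (integrable_cstR mu 1) theta_int.
  have : {ae mu, forall x, 1 - theta x = 0}.
    apply: Rintegral_eq0_ae => //.
    - by apply: filterS thpq => x; rewrite -q1E subr_ge0 => /andP[].
    - rewrite RintegralB//; last exact: integrable_cstR.
      by rewrite Rintegral_cst1 theta1 subrr.
  move=> th1; have : kappa = H.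
    rewrite -theta_moment; apply: ae_eq_Rintegral => //.
      exact: measurable_funM.
    apply: filterS th1 => x /eqP; rewrite subr_eq0 => /eqP <-.
    by rewrite mul1r.
  by move=> kHE; rewrite kHE ltxx in kH.
have qp0 : 0 < q - p by lra.
pose tau := (1 - p) / (q - p).
have tau01 : 0 <= tau < 1.
  by rewrite divr_ge0 ?ltr_pdivrMr//; lra.
have [phi [mphi phi01 phi_mono phi_tau phi_min]] :=
  neyman_pearson mh h_ge0 h_int tau01.
(* Off a null set psi is the affine rescaling of theta from [p, q] to [0, 1];
   the truncation makes the bounds hold everywhere. *)
pose psi x := Num.min 1 (Num.max 0 ((theta x - p) / (q - p))).
have psi01 x : 0 <= psi x <= 1.
  by rewrite /psi le_min ler01 le_max lexx/= ge_min lexx.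
have psiE : {ae mu, forall x, psi x = (q - p)^-1 * theta x - (q - p)^-1 * p}.
  apply: filterS thpq => x /andP[px xq].
  rewrite /psi max_r; last by rewrite divr_ge0//; lra.
  rewrite min_r ?ler_pdivrMr//; last lra.
  by rewrite mulrC mulrBr.
have mpsi : measurable_fun setT psi.
  apply: measurable_minr => //; apply: measurable_maxr => //.
  by apply: measurable_funM => //; exact: measurable_funB.
have psi_tau : \int[mu]_x psi x = tau.
  have i1 := integrableZlR (q - p)^-1 theta_int.
  have i2 := integrable_cstR mu ((q - p)^-1 * p).
  have i12 := integrableBR i1 i2.
  rewrite (ae_eq_Rintegral mpsi (integrable_measurableR i12) psiE).
  rewrite RintegralB// RintegralZl// Rintegral_cst1 theta1 /tau; field.
  by rewrite gt_eqF.
have psih : \int[mu]_x (psi x * h x) = (q - p)^-1 * (kappa - p * H).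
  have i1 := integrableZlR (q - p)^-1 htheta_int.
  have i2 := integrableZlR ((q - p)^-1 * p) h_int.
  have i12 := integrableBR i1 i2.
  rewrite (ae_eq_Rintegral (g := fun x => (q - p)^-1 * (theta x * h x) -
    (q - p)^-1 * p * h x)).
  - rewrite RintegralB// !RintegralZl// theta_moment -/H; ring.
  - exact: measurable_funM.
  - exact: integrable_measurableR i12.
  - by apply: filterS psiE => x ->; ring.
have := phi_min _ mpsi psi01 psi_tau; rewrite psih => phih_le.
have iphi : mu.-integrable setT (EFin \o phi).
  apply: (le_integrableR (g := fun=> 1)) => //.
    by move=> x; have /andP[? ?] := phi01 x; rewrite ger0_norm.
  exact: integrable_cstR.
have iphih : mu.-integrable setT (EFin \o (fun x => phi x * h x)).
  apply: (le_integrableR (g := h)) => //; first exact: measurable_funM.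
  move=> x; have /andP[x0 x1] := phi01 x; have hx := h_ge0 x.
  by rewrite ger0_norm ?mulr_ge0//; nra.
pose phih := \int[mu]_x (phi x * h x).
pose kstar := p * H + (q - p) * phih.
have kstar_le : kstar <= kappa.
  have : (q - p) * phih <= (q - p) * ((q - p)^-1 * (kappa - p * H)).
    by rewrite ler_wpM2l// ltW.
  by rewrite mulrA divff ?gt_eqF// mul1r /kstar; lra.
pose t := (H - kappa) / (H - kstar).
have t01 : 0 <= t <= 1.
  by rewrite divr_ge0 ?ler_pdivrMr//; lra.
have Hk0 : 0 < H - kstar by lra.
have tE : t * (H - kstar) = H - kappa by rewrite mulfVK// gt_eqF.
case/andP: t01 => t0 t1.
pose A := 1 - t + t * p; pose B := t * (q - p).
have B0 : 0 <= B by rewrite mulr_ge0// ltW.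
pose theta' x := A + B * phi x.
have pq' x : p <= theta' x <= q.
  have /andP[x0 x1] := phi01 x; rewrite /theta' /A /B.
  have : t * ((q - p) * phi x) <= t * (q - p).
    by rewrite ler_wpM2l// ler_piMr// ltW.
  have : 0 <= t * ((q - p) * phi x) by rewrite mulr_ge0// mulr_ge0// ltW.
  have : 0 <= (1 - t) * (1 - p) by rewrite mulr_ge0//; lra.
  have : 0 <= (1 - t) * (q - 1) by rewrite mulr_ge0//; lra.
  lra.
have ith' : mu.-integrable setT (EFin \o theta').
  apply: integrableDR; first exact: integrable_cstR.
  exact: integrableZlR.
have th'hE : (fun x => theta' x * h x) = (fun x => A * h x + B * (phi x * h x)).
  by apply/funext => x; rewrite /theta'; ring.
exists theta'; split.
- exact: integrable_measurableR ith'.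
- by move=> x; have /andP[px qx] := pq' x;
    exact: (extend_eq0_between f_convex f_ge0 f1 fp fq px qx).
- by move=> x; have /andP[px qx] := pq' x; exact: le_trans px.
- by move=> x y xy; rewrite lerD2l ler_wpM2l// phi_mono.
- have i1 := integrableZlR A h_int.
  have i2 := integrableZlR B iphih.
  split => //.
  + rewrite RintegralD//; [|exact: integrable_cstR|exact: integrableZlR].
    rewrite Rintegral_cst1 RintegralZl// phi_tau /A /B /tau; field.
    by rewrite gt_eqF.
  + by rewrite th'hE; exact: integrableDR.
  + rewrite th'hE RintegralD// !RintegralZl// -/H -/phih /A /B.
    by move: tE; rewrite /kstar; lra.
Qed.

End rearrangement.

Section optimum.
Context d (T : measurableType d) (R : realType) (mu : probability T R).
Variables (f : R -> R) (alpha : R).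
Hypothesis f_convex : @convex_function R R^o `]0, +oo[%classic f.
Hypothesis f_ge0 : forall x : R, 0 < x -> 0 <= f x.
Hypothesis f1 : f 1 = 0.
Hypothesis slope_f : slope_infty f = alpha%:E.
Hypothesis alpha_ge0 : 0 <= alpha.
Variables (h : T -> R) (kappa : R).
Hypothesis h_ge0 : forall x, 0 <= h x.
Hypothesis h_int : mu.-integrable setT (EFin \o h).
Hypothesis kappa_ge0 : 0 <= kappa.
Hypothesis kappa_lt : kappa < \int[mu]_x h x.

(** If eta > 0, theta itself will do. Otherwise the cost inequality forces the
    cost of theta to vanish, so every density valued in the zeros of f, with
    free singular mass, is optimal: it remains to choose a monotone one with the
    right moment. If alpha = 0 singular mass is free and a constant density
    suffices; if alpha > 0 there is no singular mass and theta is rearranged. *)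
Lemma monotone_optimum_exists (theta : T -> R) (lambda eta : R) :
  (forall x, 0 <= theta x) ->
  mu.-integrable setT (EFin \o theta) ->
  mu.-integrable setT (EFin \o fun x => theta x * h x) ->
  0 <= lambda ->
  {ae mu, forall x,
    subdifferential f (theta x) (alpha - lambda - eta * h x)} ->
  \int[mu]_x theta x <= 1 -> \int[mu]_x (theta x * h x) = kappa ->
  lambda * (\int[mu]_x theta x - 1) = 0 ->
  exists theta' : T -> R,
    [/\ forall x, 0 <= theta' x,
        mu.-integrable setT (EFin \o theta'),
        \int[mu]_x theta' x <= 1,
        mu.-integrable setT (EFin \o fun x => theta' x * h x) &
        \int[mu]_x (theta' x * h x) = kappa] /\
    (exists N, [/\ measurable N, mu N = 0%E &
      forall x y, ~ N x -> ~ N y -> h x < h y -> theta' y <= theta' x]) /\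
    forall (xi : T -> R) (s : R), measurable_fun setT xi ->
      (forall x, 0 <= xi x) -> (\int[mu]_x (xi x)%:E = (1 - s)%:E)%E ->
      0 <= s -> (\int[mu]_x (xi x * h x)%:E <= kappa%:E)%E ->
      (\int[mu]_x extend f (theta' x) +
          (alpha * (1 - \int[mu]_x theta' x))%:E
        <= \int[mu]_x extend f (xi x) + (alpha * s)%:E)%E.
Proof.
move=> th0 thi hthi l0 sub th1 thk sl.
have [eta0|eta_le0] := ltP 0 eta.
  exists theta; split => //; split.
    exact: (optimal_density_monotone f_convex f_ge0 f1 sub eta0).
  move=> xi s mxi xi0 xi1 s0 xih.
  exact: (optimal_density_lower_bound f_convex f_ge0 f1 h_ge0 h_int thi
    hthi l0 sub thk sl (ltW eta0) mxi xi0 xi1 s0 xih).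
have [Fi Fae FE cost] := optimal_density_cost f_convex f_ge0 f1 h_int thi hthi
  sub thk sl.
have F0 x : 0 <= fine (extend f (theta x)).
  by rewrite fine_ge0// extend_ge0.
have iF0 : 0 <= \int[mu]_x fine (extend f (theta x)) by exact: Rintegral_ge0.
have d0 : 0 <= alpha * (1 - \int[mu]_x theta x).
  by rewrite mulr_ge0// subr_ge0.
have e0 : eta * (\int[mu]_x h x - kappa) <= 0.
  by rewrite mulr_le0_ge0// subr_ge0 ltW.
have iF : \int[mu]_x fine (extend f (theta x)) = 0 by lra.
have ad : alpha * (1 - \int[mu]_x theta x) = 0 by lra.
have zero : {ae mu, forall x, extend f (theta x) = 0%E}.
  have := Rintegral_eq0_ae Fi (aeW _ F0) iF.
  by apply: filterS2 Fae => x -> /= ->.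
have bound (xi : T -> R) s : 0 <= s ->
    (0 <= \int[mu]_x extend f (xi x) + (alpha * s)%:E)%E.
  move=> s0; apply: adde_ge0; last by rewrite lee_fin mulr_ge0.
  by apply: integral_ge0 => x _; exact: extend_ge0.
have [alpha0|alpha_neq0] := eqVneq alpha 0.
  pose k := kappa / \int[mu]_x h x.
  have H0 : 0 < \int[mu]_x h x by exact: le_lt_trans kappa_lt.
  have fk : extend f k = 0%E.
    exact: (weighted_average_zero f_convex f_ge0 f1 h_ge0 h_int kappa_ge0
      kappa_lt hthi thk zero).
  exists (fun=> k); split; [split|split].
  - by move=> x; rewrite divr_ge0// ltW.
  - exact: integrable_cstR.
  - by rewrite Rintegral_cst1 ler_pdivrMr// mul1r ltW.
  - exact: integrableZlR.
  - by rewrite RintegralZl// mulfVK// gt_eqF.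
  - by exists set0; split.
  move=> xi s _ _ _ s0 _; rewrite fk integral0 alpha0 mul0r adde0.
  by have := bound xi s s0; rewrite alpha0.
have thE : \int[mu]_x theta x = 1.
  by move/eqP: ad; rewrite mulf_eq0 (negbTE alpha_neq0) subr_eq0/= => /eqP.
have slope0 : slope_infty f <> 0%E.
  by rewrite slope_f => -[] /eqP; rewrite (negbTE alpha_neq0).
have [xi [mxi fxi xi0 xi_mono [ixi xi1 ixih xih]]] :=
  zero_density_rearrangement f_convex f_ge0 f1 h_ge0 h_int
    kappa_lt thi hthi thk zero slope0 thE.
exists xi; split; [split => //|split].
- by rewrite xi1.
- by exists set0; split => // x y _ _; exact: xi_mono.
- move=> xi' s _ _ _ s0 _; rewrite xi1 subrr mulr0 adde0.
  under eq_integral do rewrite fxi.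
  by rewrite integral0; exact: bound.
Qed.

End optimum.

(** * Reduction of the mean constraint to a nonnegative gauge *)

Section full_measure.
Context d (T : measurableType d) (R : realType) (P : probability T R).
Variables (D E : set T).
Hypothesis mD : measurable D.
Hypothesis mE : measurable E.
Hypothesis E_full : P E = 1%E.
Hypothesis ED : E `<=` D.

Lemma full_ae : {ae P, forall x, E x}.
Proof.
exists (~` E); split => //; first exact: measurableC.
have := probability_setC P mE; rewrite E_full subee//.
Qed.

Lemma patch_measurable (g : T -> R) : measurable_fun D g ->
  measurable_fun setT (g \_ E).
Proof.
move=> mg; apply/(measurable_restrictT _ mE).1.
exact: measurable_funS mg.
Qed.

Lemma patch_integrable (g : T -> R) : P.-integrable D (EFin \o g) ->
  P.-integrable setT (EFin \o (g \_ E)).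
Proof.
move=> gi; rewrite -restrict_EFin -integrable_mkcond//.
exact: integrableS gi.
Qed.

Lemma full_Rintegral (g : T -> R) : measurable_fun D g ->
  \int[P]_(x in D) g x = \int[P]_x (g \_ E) x.
Proof.
move=> mg; rewrite Rintegral_mkcond; apply: ae_eq_Rintegral.
- exact/(measurable_restrictT _ mD).1.
- exact: patch_measurable.
- apply: filterS full_ae => x Ex.
  by rewrite !patchE mem_set ?mem_set//; exact: ED.
Qed.

End full_measure.

Section dominance.
Local Open Scope ereal_scope.
Context d (T : measurableType d) (R : realType) (P : probability T R).

(** A density nonincreasing in h crosses the level 1 once: if it exceeds 1
    somewhere off A, it is at least 1 on A, where it then carries at least the
    mass of P, so what is left for the complement is at most P (~` A). If not, it
    is at most 1 off A. *)
Lemma lower_set_dominance (h theta : T -> R) (N A : set T) :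
  measurable_fun setT theta -> (forall x, (0 <= theta x)%R) ->
  \int[P]_x (theta x)%:E <= 1 ->
  measurable N -> P N = 0 ->
  (forall x y, ~ N x -> ~ N y -> (h x < h y)%R -> (theta y <= theta x)%R) ->
  measurable A ->
  (forall x y, ~ N x -> ~ N y -> A x -> ~ A y -> (h x < h y)%R) ->
  \int[P]_(x in ~` A) (theta x)%:E <= P (~` A).
Proof.
move=> mth th0 th1 mN N0 mono mA lowA.
have mCA : measurable (~` A) by exact: measurableC.
have mEth (B : set T) : measurable_fun B (EFin \o theta).
  by apply: measurable_funTS; exact/measurable_EFinP.
have aeN (B : set T) (Q : T -> Prop) : (forall x, B x -> ~ N x -> Q x) ->
    {ae P, forall x, B x -> Q x}.
  move=> BQ; exists N; split => // x /=.
  by move=> /not_implyP[Bx nQ]; apply: contrapT => /(BQ _ Bx).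
have cst1 (B : set T) : measurable B -> \int[P]_(x in B) 1 = P B.
  by move=> mB; rewrite integral_cst// mul1e.
have [[v [Nv Av thv]]|no] :=
    pselect (exists v, [/\ ~ N v, ~ A v & (1 < theta v)%R]); last first.
  rewrite -cst1//; apply: ae_ge0_le_integral => //.
  - by move=> x _; rewrite lee_fin.
  - apply: aeN => x Ax Nx; rewrite lee_fin leNgt; apply/negP => thx.
    by apply: no; exists x.
have Ale : P A <= \int[P]_(x in A) (theta x)%:E.
  rewrite -cst1//; apply: ae_ge0_le_integral => //.
  - by move=> x _; rewrite lee_fin.
  - apply: aeN => x Ax Nx; rewrite lee_fin.
    by apply: le_trans (ltW thv) (mono _ _ Nx Nv (lowA _ _ Nx Nv Ax Av)).
have : \int[P]_(x in A) (theta x)%:E + \int[P]_(x in ~` A) (theta x)%:E <= 1.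
  rewrite -ge0_integral_setU//; first by rewrite setUv.
  - by move=> x _; rewrite lee_fin.
  - by rewrite disj_set2E setICr.
have PAfin : P A \is a fin_num by exact: fin_num_measure.
rewrite probability_setC//.
move=> sum1; rewrite leeBrDr// addeC; apply: le_trans sum1.
by rewrite leeD2r.
Qed.

End dominance.

(** The integral in the definition of calP is taken over the reals with their
    Borel structure, those elsewhere over the measurable type that carries the
    measures: the two structures have the same measurable sets, and transport
    along the identity shows that the integrals agree. *)
Lemma calPE {R : realType} (rho : \bar R) (S : R -> R)
    (nu : probability (measurableTypeR R) R) :
  measurable_fun (eitv0 rho) S ->
  calP rho S nu <-> nu (eitv0 rho) = 1%E /\
    (@integral _ (measurableTypeR R) R nu (eitv0 rho) (fun x => `|S x|%:E)
      < +oo)%E.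
Proof.
move=> mS; have mD := measurable_eitv0 rho.
have mES : measurable_fun (eitv0 rho) (fun x => `|S x|%:E).
  by apply/measurable_EFinP; exact: measurableT_comp.
have mid : measurable_fun setT (idfun : measurableTypeR R -> R).
  exact: measurable_id.
have E := @ge0_integral_pushforward _ _ (measurableTypeR R) R R
  (idfun : measurableTypeR R -> R) mid nu (eitv0 rho) (fun x => `|S x|%:E)
  mD mES (fun y _ => normr_ge0 (S y)).
by rewrite -[X in _ <-> (_ /\ (X < _)%E)]E.
Qed.

Section reduction.
Context {R : realType}.
Variables (rho : \bar R) (S : R -> R).
Notation D := (eitv0 rho).
Notation TR := (measurableTypeR R).
Notation PR := (probability TR R).
Variables (E : set R) (c eps : R).
Hypothesis S_meas : measurable_fun D S.
Hypothesis mE : measurable E.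
Hypothesis ED : E `<=` D.
Hypothesis eps2 : eps * eps = 1.
Hypothesis S_side : forall u, E u -> 0 <= eps * (S u - S c).

(** The common form of the two problems: eps is 1 with c the left end of E, or -1
    with c its right end. The gauge measures the distance from c on the scale S,
    and is set to zero off E so that integrals may run over the whole line. *)
Definition gauge : R -> R := (fun u => eps * (S u - S c)) \_ E.

Lemma gaugeE u : E u -> gauge u = eps * (S u - S c).
Proof. by move=> Eu; rewrite /gauge patchE mem_set. Qed.

Lemma gauge_ge0 u : 0 <= gauge u.
Proof.
rewrite /gauge patchE; case: ifPn => //; rewrite inE; exact: S_side.
Qed.

Lemma gauge_measurable : measurable_fun setT gauge.
Proof.
apply: (patch_measurable (T := TR) (measurable_eitv0 rho) mE ED).
by apply: measurable_funM => //; exact: measurable_funB.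
Qed.

(** Fixing the mean of S amounts to fixing the moment of the gauge. *)
Lemma gauge_moment (nu : PR) : nu E = 1%E -> calP rho S nu ->
  nu.-integrable setT (EFin \o gauge) /\
  \int[nu]_x gauge x = eps * (mean rho S nu - S c).
Proof.
move=> nuE /(calPE nu S_meas)[nuD Soo]; have mD := measurable_eitv0 rho.
have Si : nu.-integrable D (EFin \o S).
  by apply/integrableP; split; [exact/measurable_EFinP|].
have SEi := patch_integrable (T := TR) mD mE ED Si.
have ci := integrable_cstR (T := TR) nu (S c).
have di := integrableBR SEi ci.
have gae : {ae nu, forall x, gauge x = eps * ((S \_ E) x - S c)}.
  apply: (ae_imply _ (full_ae (T := TR) mE nuE)) => x Ex.
  by rewrite gaugeE// patchE mem_set.
have ei := integrableZlR eps di.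
have mg := gauge_measurable.
have me := integrable_measurableR ei.
split.
- apply/integrableP; split; first exact/measurable_EFinP.
  have /integrableP[_] := ei; apply: le_lt_trans.
  apply: ae_ge0_le_integral => //.
  + by apply: measurableT_comp => //; exact/measurable_EFinP.
  + by apply: measurableT_comp => //; exact/measurable_EFinP.
  + by apply: (ae_imply _ gae) => x gx _; rewrite /= gx.
- rewrite (ae_eq_Rintegral (T := TR) mg me gae).
  rewrite RintegralZl// RintegralB// Rintegral_cst1.
  by rewrite /mean (full_Rintegral (T := TR) mD mE).
Qed.

Lemma gauge_calP (nu : PR) : nu E = 1%E ->
  (\int[nu]_x (gauge x)%:E < +oo)%E -> calP rho S nu.
Proof.
move=> nuE goo; have mD := measurable_eitv0 rho.
have nuD : nu D = 1%E.
  apply/eqP; rewrite eq_le probability_le1//= -nuE le_measure ?inE//.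
apply/(calPE nu S_meas); split => //.
have mES : measurable_fun D (fun x => `|S x|%:E).
  by apply/measurable_EFinP; exact: measurableT_comp.
have mg := gauge_measurable.
have -> : (\int[nu]_(x in D) `|S x|%:E =
    \int[nu]_x ((fun x => `|S x|%:E) \_ D) x)%E by exact: integral_mkcond.
apply: (@le_lt_trans _ _ (\int[nu]_x ((gauge x)%:E + `|S c|%:E))%E).
  apply: ae_ge0_le_integral => //.
  - by move=> x _; rewrite patchE; case: ifPn => // _; rewrite lee_fin.
  - exact: (measurable_restrictT (T1 := TR) (fun x => `|S x|%:E) mD).1 mES.
  - by move=> x _; rewrite -EFinD lee_fin addr_ge0// gauge_ge0.
  - by apply: emeasurable_funD => //; exact/measurable_EFinP.
  - apply: (ae_imply _ (full_ae (T := TR) mE nuE)) => x Ex _.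
    rewrite patchE mem_set; last exact: ED.
    rewrite -EFinD lee_fin -lerBlDr gaugeE//.
    apply: le_trans (lerB_dist _ _) _.
    rewrite -(ger0_norm (S_side Ex)) normrM.
    suff -> : `|eps| = 1 by rewrite mul1r.
    by apply/eqP; rewrite -sqrp_eq1// -normrX expr2 eps2 normr1.
rewrite ge0_integralD//; first last.
- exact/measurable_EFinP.
- by move=> x _; rewrite lee_fin gauge_ge0.
apply: lte_add_pinfty => //.
have -> : (\int[nu]_(x in setT) `|S c|%:E = `|S c|%:E * nu setT)%E.
  exact: integral_cst.
rewrite (probability_setT nu) mule1; exact: ltry.
Qed.

End reduction.

(** * The common form of the two problems *)

Lemma ge0_integral_eq0 d (T : measurableType d) (R : realType)
    (m : {measure set T -> \bar R}) (N : set T) (g : T -> \bar R) :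
  measurable N -> m N = 0%E -> measurable_fun setT g ->
  (forall x, ~ N x -> g x = 0%E) -> (\int[m]_x g x = 0)%E.
Proof.
move=> mN N0 mg g0.
transitivity (\int[m]_x (cst 0 x : \bar R))%E; last by rewrite integral0.
apply: ae_eq_integral => //; exists N; split => // x /= /not_implyP[_ gx].
by apply: contrapT => /g0.
Qed.

Lemma integrable_centered d (T : measurableType d) (R : realType)
    (P : probability T R) (D : set T) (mD : measurable D) (g s : T -> R)
    (k : R) : P.-integrable D (EFin \o g) ->
  P.-integrable D (fun u => (s u * g u)%:E) ->
  P.-integrable D (EFin \o fun u => g u * (s u - k)).
Proof.
move=> gi sgi; have kgi := integrableZl mD k gi.
apply: eq_integrable (integrableB mD sgi kgi) => // x _.
by rewrite /=; congr EFin; ring.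
Qed.

Section one_sided.
Context {R : realType}.
Variables (rho : \bar R) (S : R -> R).
Notation D := (eitv0 rho).
Notation TR := (measurableTypeR R).
Notation PR := (probability TR R).
Variables (E : set R) (c eps : R).
Hypothesis S_meas : measurable_fun D S.
Hypothesis mE : measurable E.
Hypothesis ED : E `<=` D.
Hypothesis Ec : E c.
Hypothesis eps2 : eps * eps = 1.
Hypothesis S_side : forall u, E u -> 0 <= eps * (S u - S c).
Variables (f : R -> R) (alpha : R).
Hypothesis f_convex : @convex_function R R^o `]0, +oo[%classic f.
Hypothesis f_ge0 : forall x : R, 0 < x -> 0 <= f x.
Hypothesis f1 : f 1 = 0.
Hypothesis slope_f : slope_infty f = alpha%:E.
Hypothesis alpha_ge0 : 0 <= alpha.
Variable mu : PR.
Hypothesis muE : mu E = 1%E.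
Hypothesis mu_calP : calP rho S mu.
Hypothesis mu_c : mu [set c] = 0%E.
Hypothesis Sc_side : 0 <= - (eps * S c).
Hypothesis mean_side : 0 < eps * mean rho S mu.

Let h := gauge S E c eps.
Let h_ge0 := gauge_ge0 S_side.
Let h_meas := gauge_measurable c eps S_meas mE ED.
Let mD := measurable_eitv0 rho.

Let patch_int (g : R -> R) : mu.-integrable D (EFin \o g) ->
  mu.-integrable setT (EFin \o (g \_ E)).
Proof. exact: (patch_integrable (T := TR) mD mE ED). Qed.

(** The multipliers read on the whole line: the density is replaced by zero off
    E and by its positive part, which changes it on a null set only. *)
Lemma patched_multiplier (theta : R -> R) (lambda eta : R) :
  mu.-integrable D (EFin \o theta) ->
  {ae mu, forall u, D u -> 0 <= theta u} ->
  mu.-integrable D (fun u => (S u * theta u)%:E) ->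
  {ae mu, forall u, D u ->
    subdifferential f (theta u) (alpha - lambda - eta * (S u - S c))} ->
  exists theta0 : R -> R,
  [/\ forall x, 0 <= theta0 x,
      mu.-integrable setT (EFin \o theta0) /\
        \int[mu]_x theta0 x = \int[mu]_(u in E) theta u,
      mu.-integrable setT (EFin \o fun x => theta0 x * h x) /\
        \int[mu]_x (theta0 x * h x) =
          eps * \int[mu]_(u in E) (theta u * (S u - S c)) &
      {ae mu, forall x,
        subdifferential f (theta0 x) (alpha - lambda - eps * eta * h x)}].
Proof.
move=> thi th0 Sthi sub.
pose G u := theta u * (S u - S c).
have Gi : mu.-integrable D (EFin \o G).
  exact: (integrable_centered (T := TR) mD (S c) thi Sthi).
pose theta0 x := Num.max 0 ((theta \_ E) x).
have thEi := patch_int thi; have GEi := patch_int Gi.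
have aeE := full_ae (T := TR) mE muE.
have th0E : {ae mu, forall x, theta0 x = (theta \_ E) x}.
  apply: (ae_imply2 _ aeE th0) => x Ex /(_ (ED Ex)) thx.
  by rewrite /theta0 max_r// patchE mem_set.
have GE : (fun x => (theta \_ E) x * h x) = (fun x => eps * (G \_ E) x).
  apply/funext => x; rewrite /h /gauge /G !patchE; case: ifPn => _.
    by ring.
  by rewrite (_ : point = 0 :> R)// !mulr0.
have eGi := integrableZlR eps GEi.
have mthE := integrable_measurableR thEi.
have meG := integrable_measurableR eGi.
have mth0 : measurable_fun setT theta0 by exact: measurable_maxr.
have th0_le x : `|theta0 x| <= `|(theta \_ E) x|.
  by rewrite /theta0; case: (lerP 0 ((theta \_ E) x)) => // _; rewrite normr0.
have th0i : mu.-integrable setT (EFin \o theta0).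
  apply: (le_integrableR (T := TR) (g := fun x => `|(theta \_ E) x|)) => //.
  exact: integrable_abse thEi.
have mth0h : measurable_fun setT (fun x => theta0 x * h x).
  exact: measurable_funM.
have th0hi : mu.-integrable setT (EFin \o fun x => theta0 x * h x).
  apply: (le_integrableR (T := TR) (g := fun x => `|eps * (G \_ E) x|)) => //.
    move=> x; have /(congr1 (fun k => k x))/= <- := GE.
    by rewrite !normrM ler_wpM2r.
  exact: integrable_abse eGi.
exists theta0; split.
- by move=> x; rewrite /theta0 le_max lexx.
- split => //; rewrite (ae_eq_Rintegral (T := TR) mth0 mthE th0E).
  by rewrite -Rintegral_mkcond.
- split => //; rewrite (ae_eq_Rintegral (T := TR) mth0h meG).
    by rewrite RintegralZl// -Rintegral_mkcond.
  apply: (ae_imply _ th0E) => x ->.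
  by have /(congr1 (fun k => k x)) := GE.
- have aeEth := ae_imply2 (fun x => @conj _ _) aeE th0E.
  apply: (ae_imply2 _ aeEth sub) => x [Ex ->].
  move=> /(_ (ED Ex)); rewrite patchE mem_set// /h gaugeE//.
  suff -> : eps * eta * (eps * (S x - S c)) = eta * (S x - S c) by [].
  by transitivity (eps * eps * (eta * (S x - S c))); [ring|rewrite eps2 mul1r].
Qed.

Let kappa := - (eps * S c).

Let kappa_lt : kappa < \int[mu]_x h x.
Proof.
have [_ ->] := gauge_moment c eps S_meas mE ED muE mu_calP.
by rewrite /kappa mulrBr; move: mean_side; lra.
Qed.

Let gauge_momentE (nu : PR) : nu E = 1%E -> calP rho S nu ->
  mean rho S nu = 0 -> (\int[nu]_x (h x)%:E)%E = kappa%:E.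
Proof.
move=> nuE nuP nu0.
have [hi hE] := gauge_moment c eps S_meas mE ED nuE nuP.
by rewrite (EFin_Rintegral hi) hE nu0 /kappa sub0r mulrN.
Qed.

Let fext_ge0 := extend_ge0 f_convex f_ge0 f1.
Let fext_meas := measurable_extend f_convex f_ge0 f1.

Let calP_D (nu : PR) : calP rho S nu -> nu D = 1%E.
Proof. by case. Qed.

(** The optimal measure has the monotone optimal density and its missing mass at
    c, where the gauge vanishes, so that the atom does not contribute to the
    moment. A competitor is compared through its Lebesgue decomposition, whose
    density has at most the moment of the competitor. *)
Theorem one_sided_optimum (theta : R -> R) (lambda eta : R) :
  mu.-integrable D (EFin \o theta) ->
  {ae mu, forall u, D u -> 0 <= theta u} ->
  mu.-integrable D (fun u => (S u * theta u)%:E) ->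
  0 <= lambda ->
  {ae mu, forall u, D u ->
    subdifferential f (theta u) (alpha - lambda - eta * (S u - S c))} ->
  \int[mu]_(u in E) theta u <= 1 ->
  \int[mu]_(u in E) (theta u * (S u - S c)) = - S c ->
  lambda * (\int[mu]_(u in E) theta u - 1) = 0 ->
  exists nu : PR,
    [/\ nu E = 1%E, calP rho S nu, mean rho S nu = 0,
        forall nu' : PR, nu' E = 1%E -> calP rho S nu' ->
          mean rho S nu' = 0 ->
          (divergence rho f mu nu <= divergence rho f mu nu')%E &
        forall A : set R, measurable A -> A c ->
          (forall x y, E x -> E y -> A x -> ~ A y -> eps * S x < eps * S y) ->
          (mu A <= nu A)%E].
Proof.
move=> thi th0 Sthi lambda0 sub th1 thS slack.
have [xi [xi_ge0 [xi_int xiE] [xih_int xihE] xi_sub]] :=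
  patched_multiplier thi th0 Sthi sub.
have xi_moment : \int[mu]_x (xi x * h x) = kappa by rewrite xihE thS mulrN.
rewrite -xiE in th1 slack.
have [hi _] := gauge_moment c eps S_meas mE ED muE mu_calP.
have [zeta [[z0 zi z1 zhi zh] [[N [mN N0 mono]] opt]]] :=
  monotone_optimum_exists (T := TR) (kappa := kappa) f_convex f_ge0 f1 slope_f
    alpha_ge0 h_ge0 hi Sc_side kappa_lt xi_ge0 xi_int xih_int lambda0 xi_sub
    th1 xi_moment slack.
have mz := integrable_measurableR zi.
have ezE := EFin_Rintegral zi.
have ez1 : (\int[mu]_x (zeta x)%:E <= 1)%E by rewrite ezE lee_fin.
have [nu [nuperp [dec perpE]]] := tilted_decomposition mz z0 ez1 mu_c.
have [_ _ _ nuE] := dec.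
have mCE : measurable (~` E) by exact: measurableC.
have muCE : mu (~` E) = 0%E by exact: probability_setC_eq0.
have perp0 (A : set R) : ~ A c -> nuperp A = 0%E.
  by move=> Ac; rewrite perpE diracE memNset ?mule0.
have nu_full : nu E = 1%E.
  have nuCE : nu (~` E) = 0%E.
    rewrite nuE// perp0 ?adde0; last exact.
    apply: null_set_integral => //.
    by apply: measurable_funTS; exact/measurable_EFinP.
  by rewrite -(setCK E) (probability_setC nu mCE) nuCE sube0.
have mEh : measurable_fun setT (EFin \o h) by exact/measurable_EFinP.
have nuh : (\int[nu]_x (h x)%:E)%E = kappa%:E.
  have -> := ge0_integral_decomposition (g := EFin \o h) dec
    (fun x => h_ge0 x) mEh.
  have -> : (\int[nuperp]_x (EFin \o h) x = 0)%E.
    apply: (ge0_integral_eq0 (T := TR) (N := ~` [set c])) => //.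
    - exact: measurableC.
    - by apply: perp0 => /=; exact.
    - move=> x /contrapT/= ->; rewrite /= /h gaugeE// subrr mulr0//.
  rewrite adde0 -zh -(EFin_Rintegral zhi).
  by apply: eq_integral => x _; rewrite /= -EFinM mulrC.
have nuP : calP rho S nu.
  apply: (gauge_calP S_meas mE ED eps2 S_side nu_full).
  by rewrite -/h nuh ltry.
have [hnui hnuE] := gauge_moment c eps S_meas mE ED nu_full nuP.
have nu_mean : mean rho S nu = 0.
  have : kappa = eps * (mean rho S nu - S c).
    by rewrite -hnuE; apply/EFin_inj; rewrite -nuh EFin_Rintegral.
  rewrite mulrBr /kappa => H; have {}H : eps * mean rho S nu = 0 by lra.
  by rewrite -[LHS]mul1r -eps2 -mulrA H mulr0.
exists nu; split => //.
- move=> nu' nu'E nu'P nu'0.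
  have [xi' [perp' dec']] := lebesgue_decomposition_exists mu nu'.
  rewrite (divergenceE (calP_D mu_calP) (calP_D nuP) fext_meas fext_ge0 dec).
  rewrite (divergenceE (calP_D mu_calP) (calP_D nu'P) fext_meas fext_ge0 dec').
  rewrite slope_f perpE diracT mule1 ezE -EFinB -EFinM.
  have [mxi' xi'0 _ nu'E'] := dec'.
  have perpfin : perp' setT \is a fin_num by exact: fin_num_measure.
  rewrite -(fineK perpfin) -EFinM.
  apply: opt => //.
  + have := probability_setT nu'; rewrite nu'E'// -{1}(fineK perpfin) => H.
    by rewrite EFinB -H addeK.
  + exact: fine_ge0.
  + rewrite -(gauge_momentE nu'E nu'P nu'0).
    have -> := ge0_integral_decomposition (g := EFin \o h) dec'
      (fun x => h_ge0 x) mEh.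
    under eq_integral do rewrite mulrC EFinM.
    by rewrite leeDl// integral_ge0// => x _; rewrite lee_fin.
- move=> A mA Ac lowA.
  have mCA : measurable (~` A) by exact: measurableC.
  have mN' : measurable (N `|` ~` E) by exact: measurableU.
  have N'0 : mu (N `|` ~` E) = 0%E by exact: null_set_setU.
  have := lower_set_dominance (T := TR) (h := h) (A := A) mz z0 ez1 mN' N'0.
  move=> /(_ _ mA) dom.
  have nuCA : (nu (~` A) <= mu (~` A))%E.
    rewrite nuE// perp0 ?adde0; last exact.
    apply: dom.
    - by move=> x y /not_orP[Nx _] /not_orP[Ny _]; exact: mono.
    - move=> x y /not_orP[_ /contrapT Ex] /not_orP[_ /contrapT Ey] Ax Ay.
      rewrite /h !gaugeE// !mulrBr ltrD2r; exact: lowA.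
  move: nuCA; rewrite !probability_setC//.
  have mufin : mu A \is a fin_num by exact: fin_num_measure.
  have nufin : nu A \is a fin_num by exact: fin_num_measure.
  by rewrite -(fineK mufin) -(fineK nufin) -!EFinB !lee_fin lerD2l lerN2.
Qed.

End one_sided.

(** * The scale function and supports *)

Section oriented.
Context {R : realType}.
Notation leb := (@lebesgue_measure R).
Implicit Types (g : R -> R) (b c x y : R).

Let itv_sub b x y : 0 <= x -> y <= b -> `[x, y]%classic `<=` `[0, b].
Proof.
move=> x0 yb u /=; rewrite !in_itv/= => /andP[xu uy].
by rewrite (le_trans x0)//= (le_trans uy).
Qed.

Lemma Rintegral_itv_increment g b x y :
  leb.-integrable `[0, b] (EFin \o g) -> 0 <= x -> x <= y -> y <= b ->
  \int[leb]_(t in `[0, y]) g t - \int[leb]_(t in `[0, x]) g t =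
  \int[leb]_(t in `[x, y]) g t.
Proof.
move=> gi x0 xy yb.
have gy : leb.-integrable `[0, y] (EFin \o g).
  by apply: integrableS gi => //; exact: itv_sub.
rewrite Rintegral_itvB//.
rewrite Rintegral_itv_obnd_cbnd//; apply: integrableS gi => // u /=.
rewrite !in_itv/= => /andP[xu uy].
by rewrite (le_trans x0 (ltW xu))/= (le_trans uy).
Qed.

(** With a common base point the two cases of the definition become one. *)
Lemma oriented_integralE g b c x :
  leb.-integrable `[0, b] (EFin \o g) -> 0 <= c <= b -> 0 <= x <= b ->
  oriented_integral c x g =
    \int[leb]_(t in `[0, x]) g t - \int[leb]_(t in `[0, c]) g t.
Proof.
move=> gi /andP[c0 cb] /andP[x0 xb]; rewrite /oriented_integral.
have [cx|/ltW xc] := leP c x.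
- exact/esym/(Rintegral_itv_increment (b := b)).
- by rewrite -(Rintegral_itv_increment (b := b))// opprB.
Qed.

Lemma eq_oriented_integral g1 g2 b c x : 0 <= c <= b -> 0 <= x <= b ->
  {in `[0, b]%classic, g1 =1 g2} ->
  oriented_integral c x g1 = oriented_integral c x g2.
Proof.
move=> /andP[c0 cb] /andP[x0 xb] g12; rewrite /oriented_integral.
by case: ifPn => _; [|congr (- _)]; apply: eq_Rintegral => t /set_mem tcx;
  apply: g12; apply/mem_set; apply: itv_sub tcx.
Qed.

Lemma increasing_primitive g b x y : {within `[0, b], continuous g} ->
  (forall t, 0 < g t) -> 0 <= x -> x < y -> y <= b ->
  \int[leb]_(t in `[0, x]) g t < \int[leb]_(t in `[0, y]) g t.
Proof.
move=> gc g0 x0 xy yb.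
have gi : leb.-integrable `[0, b] (EFin \o g).
  by apply: continuous_compact_integrable => //; exact: segment_compact.
rewrite -subr_gt0 (Rintegral_itv_increment (b := b))//; last exact: ltW.
have gxy : leb.-integrable `[x, y] (EFin \o g).
  by apply: integrableS gi => //; exact: itv_sub.
have [m _ mmin] := EVT_min (le_trans x0 (le_trans (ltW xy) yb)) gc.
apply: (@lt_le_trans _ _ (g m * (y - x))); first by rewrite mulr_gt0// subr_gt0.
have lxy : leb (`[x, y]%classic : set R) = (y - x)%:E.
  by rewrite lebesgue_measure_itv/= lte_fin xy -EFinB.
have -> : g m * (y - x) = \int[leb]_(t in `[x, y]) g m.
  by rewrite Rintegral_cst//; congr (_ * _); exact: esym (congr1 fine lxy).
apply: le_Rintegral => //.
- apply: continuous_compact_integrable; first exact: segment_compact.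
  by apply: continuous_subspaceT => ?; exact: cst_continuous.
- by move=> t txy; apply: mmin; apply: itv_sub txy.
Qed.

End oriented.

Section scale.
Context {R : realType}.
Variables (ell rho : \bar R) (r0 : R) (a sigma : R -> R).
Hypothesis ell_lt0 : (ell < 0)%E.
Hypothesis r0_gt0 : 0 < r0.
Hypothesis r0_rho : (r0%:E < rho)%E.
Hypothesis a_meas : measurable_fun (eitv_oo ell rho) a.
Hypothesis var_meas :
  measurable_fun (eitv_oo ell rho) (fun x => 1 / sigma x ^+ 2).
Hypothesis loc_int :
  locally_integrable (eitv_oo ell rho) (fun x => `|a x| / sigma x ^+ 2).

Notation S := (scale_function r0 a sigma).
Notation leb := (@lebesgue_measure R).
Let phi r := a r / sigma r ^+ 2.

Let segment_sub b : (b%:E < rho)%E -> `[0, b]%classic `<=` eitv_oo ell rho.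
Proof.
move=> brho u /=; rewrite in_itv/= => /andP[u0 ub]; split.
  by apply: lt_le_trans ell_lt0 _; rewrite lee_fin.
by apply: le_lt_trans brho; rewrite lee_fin.
Qed.

Let measurable_I : measurable (eitv_oo ell rho).
Proof.
apply: is_interval_measurable => x y [x0 xr] [y0 yr] z /andP[xz zy]; split.
  by apply: lt_le_trans x0 _; rewrite lee_fin.
by apply: le_lt_trans yr; rewrite lee_fin.
Qed.

(** Measurability of the quotient comes from that of 1 / sigma ^ 2, and its
    integrability from local integrability on the compact interval. *)
Lemma drift_integrable b : (b%:E < rho)%E ->
  leb.-integrable `[0, b] (EFin \o phi).
Proof.
move=> brho; have sub := segment_sub brho.
have [mloc _ /(_ _ sub (segment_compact (a := 0) (b := b))) fin] := loc_int.
apply/integrableP; split.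
  apply/measurable_EFinP; apply: (measurable_funS measurable_I sub).
  have -> : phi = (fun x => a x * (1 / sigma x ^+ 2)).
    by apply/funext => x; rewrite mul1r.
  exact: measurable_funM.
apply: le_lt_trans fin; rewrite le_eqVlt; apply/orP; left; apply/eqP.
apply: eq_integral => u _; rewrite /= /phi !normrM normr_id.
by congr (_ * _)%:E; rewrite normfV.
Qed.

Let kernel u := expR (- 2 * oriented_integral r0 u phi).

(** On [0, b] the inner integral is a difference of values of a primitive, hence
    continuous. *)
Let kernel_continuous b : r0 <= b -> (b%:E < rho)%E ->
  exists2 g : R -> R, {within `[0, b], continuous g} /\ (forall t, 0 < g t) &
    {in `[0, b]%classic, kernel =1 g}.
Proof.
move=> r0b brho; have phii := drift_integrable brho.
have b0 : 0 <= b := le_trans (ltW r0_gt0) r0b.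
pose P u := \int[leb]_(t in `[0, u]) phi t.
pose k p := expR (- 2 * (p - P r0)).
exists (k \o P); first split.
- apply: within_continuous_comp.
    move=> p _.
    apply: (@continuous_comp _ _ _ (fun p => - 2 * (p - P r0)) expR).
      apply: cvgM; first exact: cvg_cst.
      by apply: cvgB; [exact: cvg_id|exact: cvg_cst].
    exact: continuous_expR.
  exact: parameterized_integral_continuous.
- by move=> t; exact: expR_gt0.
- move=> u /set_mem/=; rewrite in_itv/= => u0b.
  by rewrite /kernel (oriented_integralE (b := b))// r0b (ltW r0_gt0).
Qed.

Lemma scale_function_r0 : S r0 = 0.
Proof.
rewrite /scale_function /oriented_integral lexx set_itv1.
exact: Rintegral_set1.
Qed.

Lemma scale_function_lt x y : 0 <= x -> x < y -> (y%:E < rho)%E -> S x < S y.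
Proof.
move=> x0 xy yrho; pose b := Num.max r0 y.
have r0b : r0 <= b by rewrite le_max lexx.
have yb : y <= b by rewrite le_max lexx orbT.
have brho : (b%:E < rho)%E by rewrite /b; case: (leP r0 y).
have [g [gc g0] kg] := kernel_continuous r0b brho.
have gi : leb.-integrable `[0, b] (EFin \o g).
  by apply: continuous_compact_integrable => //; exact: segment_compact.
have r0ab : 0 <= r0 <= b by rewrite (ltW r0_gt0).
have SE u : 0 <= u <= b ->
    S u = \int[leb]_(t in `[0, u]) g t - \int[leb]_(t in `[0, r0]) g t.
  move=> ub; rewrite -(oriented_integralE (b := b))//.
  exact: eq_oriented_integral kg.
rewrite !SE ?x0 ?yb ?(le_trans x0 (ltW xy)) ?(le_trans (ltW xy) yb)//.
by rewrite ltrD2r; exact: (increasing_primitive (b := b)).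
Qed.

Lemma scale_function_le x y : 0 <= x -> x <= y -> (y%:E < rho)%E -> S x <= S y.
Proof.
move=> x0; rewrite le_eqVlt => /predU1P[->//|xy] yrho.
by apply/ltW/scale_function_lt.
Qed.

Lemma scale_function_measurable : measurable_fun (eitv0 rho) S.
Proof.
apply: (measurability (@RGenCInfty.G R)) => [|/= _ [_] [r] -> <-].
  exact: RGenCInfty.measurableE.
apply: is_interval_measurable => s t/= [[s0 srho]] + [[t0 trho] _].
rewrite !in_itv/= !andbT => rs u /andP[su ut].
have urho : (u%:E < rho)%E by apply: le_lt_trans trho; rewrite lee_fin.
split; first by split => //; exact: le_trans su.
by rewrite in_itv/= andbT (le_trans rs)// scale_function_le.
Qed.

End scale.

Lemma measure_bigcup_eq0 d (T : measurableType d) (R : realType)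
    (m : {measure set T -> \bar R}) (F : (set T)^nat) :
  (forall n, measurable (F n)) -> (forall n, m (F n) = 0%E) ->
  m (\bigcup_n F n) = 0%E.
Proof.
move=> mF F0; apply: measure_negligible; first exact: bigcupT_measurable.
by apply: negligible_bigcup => n; exists (F n); split.
Qed.

Section support.
Context {R : realType}.
Notation TR := (measurableTypeR R).
Notation PR := (probability TR R).

(** The complement of the support is a union of null open intervals with
    rational endpoints, hence null. *)
Lemma msupport_full (nu : PR) (x y : R) :
  msupport nu `<=` `[x, y] -> nu `[x, y]%classic = 1%E.
Proof.
move=> supp.
pose I (pq : rat * rat) : set R := `]ratr pq.1, ratr pq.2[%classic.
pose F (n : nat) : set R :=
  if unpickle n is Some pq then if nu (I pq) == 0%E then I pq else set0
  else set0.
have mF n : measurable (F n).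
  rewrite /F; case: unpickle => [pq|]; last exact: measurable0.
  by case: ifPn => // _; exact: measurable_itv.
have F0 n : nu (F n) = 0%E.
  rewrite /F; case: unpickle => [pq|]; last exact: measure0.
  by case: ifPn => [/eqP//|_]; exact: measure0.
have mU : measurable (\bigcup_n F n) by exact: bigcupT_measurable.
have U0 : nu (\bigcup_n F n) = 0%E.
  exact: (measure_bigcup_eq0 (T := TR) mF F0).
have sub : ~` `[x, y]%classic `<=` \bigcup_n F n.
  move=> u uxy; have : ~ msupport nu u by move=> /supp.
  move=> /existsNP[U] /not_implyP[oU] /not_implyP[Uu] /negP nuU.
  have {}nuU : nu U = 0%E.
    by apply/eqP; rewrite eq_le measure_ge0 andbT leNgt.
  have /nbhs_ballP[e /= e0 eU] : nbhs u U by exact: open_nbhs_nbhs.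
  have ue : u - e < u by rewrite gtrBl.
  have eu : u < u + e by rewrite ltrDl.
  have [p] := rat_in_itvoo ue; have [q] := rat_in_itvoo eu.
  rewrite !in_itv/= => /andP[uq qe] /andP[ep pu].
  have mI : measurable (I (p, q)) by exact: measurable_itv.
  have I0 : nu (I (p, q)) = 0%E.
    apply/eqP; rewrite eq_le measure_ge0 andbT -nuU le_measure ?inE//.
      exact: open_measurable.
    move=> v; rewrite /I/= in_itv/= => /andP[pv vq]; apply: eU.
    by rewrite /ball/= ltr_distl; apply/andP; split; lra.
  exists (pickle (p, q)); first exact: Logic.I.
  suff -> : F (pickle (p, q)) = I (p, q) by rewrite /I/= in_itv/= pu uq.
  by rewrite /F pickleK I0 eqxx.
have mxy : measurable (`[x, y]%classic : set R) by exact: measurable_itv.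
have mCxy : measurable (~` `[x, y]%classic : set R) by exact: measurableC.
have C0 : nu (~` `[x, y]%classic) = 0%E.
  by apply/eqP; rewrite eq_le measure_ge0 andbT -U0 le_measure ?inE.
by rewrite -[X in nu X]setCK (probability_setC nu mCxy) C0 sube0.
Qed.

End support.

(** * The two minimization problems *)

Theorem proposition20 (R : realType)
    (ell rho : \bar R) (r0 : R) (a sigma : R -> R)
    (hell : (ell < 0)%E) (hr0 : 0 < r0) (hrho : (r0%:E < rho)%E)
    (ha : measurable_fun (eitv_oo ell rho) a)
    (hsigma : measurable_fun (eitv_oo ell rho) sigma)
    (hsigma_gt0 : forall x, eitv_oo ell rho x -> 0 < sigma x ^+ 2)
    (hloc1 : locally_integrable (eitv_oo ell rho) (fun x => 1 / sigma x ^+ 2))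
    (hloc2 : locally_integrable (eitv_oo ell rho) (fun x => `|a x| / sigma x ^+ 2))
    (f : R -> R)
    (hf_convex : @convex_function R R^o `]0, +oo[%classic f)
    (hf_ge0 : forall x : R, 0 < x -> 0 <= f x) (hf1 : f 1 = 0)
    (hf_slope : (0 <= slope_infty f)%E)
    (alpha : R) (halpha : slope_infty f = alpha%:E)
    (mu : probability (measurableTypeR R) R)
    (hmu : calP rho (scale_function r0 a sigma) mu) :
  let S := scale_function r0 a sigma in
  let D := eitv0 rho in
  (0 < mean rho S mu -> mu [set 0] = 0%E ->
   forall (theta : R -> R) (lambda eta : R),
     mu.-integrable D (EFin \o theta) ->
     {ae mu, forall u, D u -> 0 <= theta u} ->
     mu.-integrable D (fun u => (S u * theta u)%:E) ->
     0 <= lambda ->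
     {ae mu, forall u, D u ->
       subdifferential f (theta u) (alpha - lambda - eta * (S u - S 0))} ->
     \int[mu]_(u in D) theta u <= 1 ->
     \int[mu]_(u in D) (theta u * (S u - S 0)) = - S 0 ->
     lambda * (\int[mu]_(u in D) theta u - 1) = 0 ->
     let nu0 := 1 - \int[mu]_(u in D) theta u in
     let nu := fun A : set R =>
       (nu0%:E * dirac (0%R : R) A + \int[mu]_(u in A `&` D) (theta u)%:E)%E in
     exists nuhat : probability (measurableTypeR R) R,
       minimizer (feasibleB rho S) (divergence rho f mu) nuhat /\
       stoch_dominates mu nuhat)
  /\
  (mean rho S mu < 0 ->
   forall M : R, r0 <= M -> (M%:E < rho)%E ->
     msupport mu `<=` `[0, M] -> mu [set M] = 0%E ->
   forall (theta : R -> R) (lambda eta : R),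
     mu.-integrable D (EFin \o theta) ->
     {ae mu, forall u, D u -> 0 <= theta u} ->
     mu.-integrable D (fun u => (S u * theta u)%:E) ->
     0 <= lambda ->
     {ae mu, forall u, D u ->
       subdifferential f (theta u) (alpha - lambda - eta * (S u - S M))} ->
     \int[mu]_(u in `[0, M]) theta u <= 1 ->
     \int[mu]_(u in `[0, M]) (theta u * (S u - S M)) = - S M ->
     lambda * (\int[mu]_(u in `[0, M]) theta u - 1) = 0 ->
     let nuM := 1 - \int[mu]_(u in `[0, M]) theta u in
     let nu := fun A : set R =>
       (nuM%:E * dirac M A + \int[mu]_(u in A `&` D) (theta u)%:E)%E in
     exists nuhat : probability (measurableTypeR R) R,
       minimizer (feasibleCM rho S M mu) (divergence rho f mu) nuhat /\
       stoch_dominates nuhat mu).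
Proof.
move=> S D; have [var_meas _ _] := hloc1.
have Slt := scale_function_lt hell hr0 hrho ha var_meas hloc2.
have Sle := scale_function_le hell hr0 hrho ha var_meas hloc2.
have mS := scale_function_measurable hell hr0 hrho ha var_meas hloc2.
have Sr0 : S r0 = 0 := scale_function_r0 r0 a sigma.
have alpha_ge0 : 0 <= alpha by move: hf_slope; rewrite halpha lee_fin.
have mD : measurable D := measurable_eitv0 rho.
have muD : mu D = 1%E by case: hmu.
have D0 : D 0.
  by split => //; apply: lt_trans hrho; rewrite lte_fin.
split.
- move=> mean_gt0 mu0 theta lambda eta thi th0 Sthi l0 sub th1 thS slack nu0 nu.
  have S_side u : D u -> 0 <= 1 * (S u - S 0).
    by move=> [u0 urho]; rewrite mul1r subr_ge0 Sle.
  have Sc_side : 0 <= - (1 * S 0).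
    by rewrite mul1r oppr_ge0 -[leRHS]Sr0 Sle// ltW.
  have mean_side : 0 < 1 * mean rho S mu by rewrite mul1r.
  have [nuhat [nuE nuP nu_mean opt dom]] :=
    one_sided_optimum mS mD (fun x Dx => Dx) D0 (mulr1 1) S_side
      hf_convex hf_ge0 hf1 halpha alpha_ge0 muD hmu mu0 Sc_side mean_side thi
      th0 Sthi l0 sub th1 thS slack.
  exists nuhat; split; first split.
  + by split.
  + by move=> nu' [nu'P nu'0]; apply: opt => //; case: nu'P.
  + move=> x; have [x_ge0|x_lt0] := leP 0 x.
      apply: dom; first exact: measurable_itv.
        by rewrite /= in_itv/=.
      move=> y z [y0 yrho] [z0 zrho]; rewrite /= !in_itv/= => yx /negP.
      by rewrite -ltNge !mul1r => xz; apply: Slt => //; exact: le_lt_trans xz.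
    have -> : mu `]-oo, x]%classic = 0%E; last exact: measure_ge0.
    apply/eqP; rewrite eq_le measure_ge0 andbT.
    rewrite -(probability_setC_eq0 mD muD) le_measure ?inE//.
      exact: measurableC.
    move=> y; rewrite /= in_itv/= => yx [y0 _].
    by have := lt_le_trans x_lt0 (le_trans y0 yx); rewrite ltxx.
- move=> mean_lt0 M r0M Mrho supp muM theta lambda eta thi th0 Sthi l0 sub th1
    thS slack nuM nu.
  pose E : set R := `[0, M]%classic.
  have mE : measurable E by exact: measurable_itv.
  have EE u : E u <-> 0 <= u <= M by rewrite /E/= in_itv.
  have ED : E `<=` D.
    move=> u /EE/andP[u0 uM]; split => //.
    by apply: le_lt_trans Mrho; rewrite lee_fin.
  have EM : E M by apply/EE; rewrite lexx andbT (le_trans (ltW hr0)).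
  have muE : mu E = 1%E by exact: msupport_full.
  have N1 : (-1) * (-1) = 1 :> R by rewrite mulrNN mulr1.
  have S_side u : E u -> 0 <= -1 * (S u - S M).
    by move=> /EE/andP[u0 uM]; rewrite mulN1r oppr_ge0 subr_le0 Sle.
  have Sc_side : 0 <= - (-1 * S M).
    by rewrite mulN1r opprK -[leLHS]Sr0 Sle// ltW.
  have mean_side : 0 < -1 * mean rho S mu by rewrite mulN1r oppr_gt0.
  have [nuhat [nuE nuP nu_mean opt dom]] :=
    one_sided_optimum mS mE ED EM N1 S_side hf_convex hf_ge0 hf1 halpha
      alpha_ge0 muE hmu muM Sc_side mean_side thi th0 Sthi l0 sub th1 thS slack.
  have nu_supp : msupport nuhat `<=` `[0, M].
    move=> x xsupp; apply: contrapT => nEx.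
    have /xsupp/(_ nEx) : open (~` `[0, M]%classic : set R).
      by apply: closed_openC; exact: itv_closed.
    by rewrite (probability_setC_eq0 mE nuE) ltxx.
  have domM : stoch_dominates nuhat mu.
    move=> x; have mx : measurable (`]-oo, x]%classic : set R).
      exact: measurable_itv.
    have mCx : measurable (~` `]-oo, x]%classic : set R) by exact: measurableC.
    have [Mx|xM] := leP M x.
      apply: (le_trans (probability_le1 nuhat mx)); rewrite -muE.
      rewrite le_measure ?inE// => u /EE/andP[_ uM].
      by rewrite /= in_itv/= (le_trans uM).
    have := dom (~` `]-oo, x]%classic) mCx.
    rewrite /= in_itv/= => /(_ _ _)H.
    have {H} : (mu (~` `]-oo, x]%classic) <= nuhat (~` `]-oo, x]%classic))%E.
      apply: H; first by apply/negP; rewrite -ltNge.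
      move=> y z /EE/andP[y0 yM] /EE/andP[z0 zM] /negP + /contrapT.
      rewrite in_itv/= -ltNge => xy zx; rewrite !mulN1r ltrN2; apply: Slt => //.
        exact: le_lt_trans xy.
      by apply: le_lt_trans Mrho; rewrite lee_fin.
    rewrite !probability_setC//.
    have mufin : mu `]-oo, x]%classic \is a fin_num by exact: fin_num_measure.
    have nufin : nuhat `]-oo, x]%classic \is a fin_num.
      exact: fin_num_measure.
    by rewrite -(fineK mufin) -(fineK nufin) -!EFinB !lee_fin lerD2l lerN2.
  exists nuhat; split => //; split; first by split.
  move=> nu' [[nu'P nu'supp] nu'0 _]; apply: opt => //.
  exact: msupport_full.
Qed.
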